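(* Let $C$ be a copula and let $\Pi=(\Pi_n)_{n\in\mathbb{N}}$ be the permutation sequence generated by $C$. Regard $\Pi$ as a process on its minimal state space $S_C=\{\pi\in\mathbb{S}:\ t(\pi,C)>0\}$ (note $P(\Pi_k=\sigma)=t(\sigma,C)$ for $\sigma\in\mathbb{S}_k$). Then: (i) $\Pi$ is a Markov chain with transition probabilities $$P(\Pi_{n+1}=\tau\mid\Pi_n=\sigma)=\frac{(n+1)\,t(\tau,C)}{t(\sigma,C)}\,p^{\mathrm H}(\sigma,\tau),\qquad n\in\mathbb{N},\ \sigma\in\mathbb{S}_n\cap S_C,\ \tau\in\mathbb{S}_{n+1},$$ where $p^{\mathrm H}(\sigma,\tau)=P(\Pi^{\mathrm H}_{n+1}=\tau\mid\Pi^{\mathrm H}_n=\sigma)$ is the one-step transition function of the double-insertion chain $\Pi^{\mathrm H}$. (ii) The Doob–Martin topology associated with $\Pi$ coincides with the pattern frequency topology (on $S_C$). (iii) $\Pi$ is a Doob $h$-transform of $\Pi^{\mathrm H}$: with $K$ the Martin kernel of $\Pi^{\mathrm H}$, continuously extended to the boundary point identified with $C$, $$P(\Pi_{n+1}=\tau\mid\Pi_n=\sigma)=\frac{K(\tau,C)}{K(\sigma,C)}\,P(\Pi^{\mathrm H}_{n+1}=\tau\mid\Pi^{\mathrm H}_n=\sigma)$$ for all $n\in\mathbb{N}$, $\sigma\in\mathbb{S}_n\cap S_C$, $\tau\in\mathbb{S}_{n+1}$.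
   Context: $\mathbb{S}_n$ is the set of permutations of $[n]$ in one-line notation, $\mathbb{S}=\bigsqcup_{n\ge1}\mathbb{S}_n$, and $|\pi|=n$ for $\pi\in\mathbb{S}_n$. Pattern frequency: for $\sigma\in\mathbb{S}_k$, $\pi\in\mathbb{S}_n$, $k\le n$, $t(\sigma,\pi)$ is the fraction of the $\binom nk$ subsets $\{i_1<\dots<i_k\}\subset[n]$ such that $\sigma(j)<\sigma(m)\Leftrightarrow\pi(i_j)<\pi(i_m)$ for all $j,m\in[k]$; $t(\sigma,\pi)=0$ if $k>n$. A copula is the distribution function of a probability measure on $[0,1]^2$ with uniform marginals. For data $(x_1,y_1),\dots,(x_n,y_n)$ without ties in either coordinate, with $\pi_x(i)=\#\{j:x_j\le x_i\}$, $\pi_y(i)=\#\{j:y_j\le y_i\}$, the associated permutation is $\pi_y\circ\pi_x^{-1}$. The permutation sequence generated by $C$: $(X_i,Y_i)_{i\in\mathbb{N}}$ i.i.d. with distribution function $C$, $\Pi_n$ = permutation associated with the first $n$ pairs. For $\sigma\in\mathbb{S}_k$, $t(\sigma,C)$ is the probability that $k$ i.i.d. points from $C$ have associated permutation $\sigma$. The chain $\Pi^{\mathrm H}$: $\Pi^{\mathrm H}_1=(1)$; from $\Pi^{\mathrm H}_n$, draw $I,J$ independent uniform on $[n+1]$ (independent of the past), insert the value $J$ at position $I$ of the one-line notation and increase by one all old values $\ge J$. Compactification by functions: given a countable family $\mathcal F$ of functions $S\to[0,1]$ separating points of a countable set $S$, embed $S$ into $[0,1]^{\mathcal F}$ (product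 topology) by $x\mapsto(f(x))_{f\in\mathcal F}$ and take the closure; a sequence converges iff $f(x_n)$ converges for all $f\in\mathcal F$. The pattern frequency topology uses $\mathcal F=\{\pi\mapsto t(\sigma,\pi):\sigma\in\mathbb{S}\}$; copulas are identified with boundary points via $\sigma\mapsto t(\sigma,C)$. For a Markov chain $(X_n)$ with $X_n\in S_n$ and $P(X_n=x)>0$ for all $x\in S_n$, the Doob–Martin topology uses $\mathcal F=\{f_x:x\in S\}$, $f_x(y)=P(X_m=x\mid X_n=y)$ for $x\in S_m$, $y\in S_n$, $n\ge m$, and $f_x(y)=0$ if $n<m$. The Martin kernel is $K(x,y)=P(X_n=y\mid X_m=x)/P(X_n=y)$ for $x\in S_m,y\in S_n$, $n\ge m$, and $0$ otherwise; it extends continuously in the second argument to the boundary, $K(x,\alpha)=\lim K(x,y_n)$ for $y_n\to\alpha$. *)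

(* Defs.v *)
From HB Require Import structures.
From mathcomp Require Import all_boot all_order all_algebra.
From mathcomp Require Import all_classical all_reals all_analysis.
Set Implicit Arguments. Unset Strict Implicit. Unset Printing Implicit Defensive.
Import Order.TTheory GRing.Theory Num.Theory numFieldNormedType.Exports.
Local Open Scope classical_set_scope.
Local Open Scope ring_scope.

(* Permutations in one-line notation, as sequences of naturals.        *)
Definition is_perm (n : nat) (s : seq nat) : bool :=
  (0 < n)%N && perm_eq s (iota 1 n).

Definition in_S (s : seq nat) : bool := is_perm (size s) s.

Definition perms_of (n : nat) : seq (seq nat) := permutations (iota 1 n).

Definition same_pattern (a b : seq nat) : bool :=
  (size a == size b) &&
  [forall j : 'I_(size a), forall l : 'I_(size a),
     (nth 0 a j < nth 0 a l) == (nth 0 b j < nth 0 b l)]%N.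

(* number of k-subsets {i_1<...<i_k} of positions of pi (encoded by masks)
   on which pi has pattern sigma *)
Definition pattern_count (sigma pi : seq nat) : nat :=
  #|[set m : (size pi).-tuple bool |
       (count id m == size sigma) && same_pattern sigma (mask m pi)]|.

Definition tpat (R : realType) (sigma pi : seq nat) : R :=
  if (size pi < size sigma)%N then 0
  else (pattern_count sigma pi)%:R / ('C(size pi, size sigma))%:R.

(* Permutation associated with data (x_1,y_1),...,(x_n,y_n):           *)
(*   pi_x(i) = #{j : x_j <= x_i},  pi_y(i) = #{j : y_j <= y_i},        *)
(*   associated permutation = pi_y o pi_x^{-1} (one-line notation).    *)
(* (Only meaningful for data without ties; ties have probability 0.)   *)
Definition rank_x (R : realType) (pts : seq (R * R)) (p : R * R) : nat :=
  count (fun q : R * R => q.1 <= p.1) pts.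
Definition rank_y (R : realType) (pts : seq (R * R)) (p : R * R) : nat :=
  count (fun q : R * R => q.2 <= p.2) pts.

Definition assoc_perm (R : realType) (pts : seq (R * R)) : seq nat :=
  [seq rank_y pts (nth (0, 0) pts (find (fun p => rank_x pts p == i) pts))
  | i <- iota 1 (size pts)].

(* Copulas: probability measures on R x R concentrated on [0,1]^2      *)
(* with uniform marginals (C is identified with its distribution fn).  *)
Definition is_copula (R : realType) (C : probability (R * R)%type R) : Prop :=
  C [set p | 0 <= p.1 <= 1 /\ 0 <= p.2 <= 1] = 1%E /\
  (forall a : R, 0 <= a <= 1 -> C [set p | p.1 <= a] = a%:E) /\
  (forall a : R, 0 <= a <= 1 -> C [set p | p.2 <= a] = a%:E).

Fixpoint iter_int (R : realType) (C : probability (R * R)%type R) (k : nat)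
  (f : seq (R * R) -> R) : R :=
  match k with
  | 0 => f [::]
  | k'.+1 => Rintegral C setT (fun p => iter_int C k' (fun l => f (p :: l)))
  end.

(* t(sigma, C): probability that |sigma| i.i.d. points with law C have
   associated permutation sigma *)
Definition tcop (R : realType) (C : probability (R * R)%type R)
  (sigma : seq nat) : R :=
  iter_int C (size sigma)
    (fun pts => if assoc_perm pts == sigma then 1 else 0).

Definition in_SC (R : realType) (C : probability (R * R)%type R)
  (s : seq nat) : bool := in_S s && (0 < tcop C s).

Definition iid_law (R : realType) (d : measure_display) (Omega : measurableType d)
  (P : probability Omega R) (X Y : nat -> Omega -> R)
  (C : probability (R * R)%type R) : Prop :=
  (forall i, measurable_fun setT (X i)) /\ (forall i, measurable_fun setT (Y i)) /\
  forall (n : nat) (B : nat -> set (R * R)), (forall i, measurable (B i)) ->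
    P [set w | forall i, (i < n)%N -> B i (X i w, Y i w)] =
    (\prod_(i < n) C (B i))%E.

Definition Pi (R : realType) (Omega : Type) (X Y : nat -> Omega -> R)
  (n : nat) (w : Omega) : seq nat :=
  assoc_perm [seq (X i w, Y i w) | i <- iota 0 n].

Definition Pr (R : realType) (d : measure_display) (Omega : measurableType d)
  (P : probability Omega R) (A : set Omega) : R := fine (P A).

Definition DM_fun (R : realType) (d : measure_display) (Omega : measurableType d)
  (P : probability Omega R) (X Y : nat -> Omega -> R) (x y : seq nat) : R :=
  if (size y < size x)%N then 0
  else Pr P [set w | Pi X Y (size x) w = x /\ Pi X Y (size y) w = y]
       / Pr P [set w | Pi X Y (size y) w = y].

(* insert value j at position i (1-based), shifting old values >= j *)
Definition insert_perm (s : seq nat) (i j : nat) : seq nat :=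
  let s' := [seq (if (j <= v)%N then v.+1 else v) | v <- s] in
  take i.-1 s' ++ j :: drop i.-1 s'.

(* one-step transition p^H(sigma, tau), I, J independent uniform on [n+1] *)
Definition pH (R : realType) (sigma tau : seq nat) : R :=
  let n := size sigma in
  (#|[set ij : 'I_n.+1 * 'I_n.+1 |
        insert_perm sigma ij.1.+1 ij.2.+1 == tau]|)%:R / (n.+1 ^ 2)%:R.

(* P(Pi^H_n = y | Pi^H_m = x) for x in S_m, (Chapman-Kolmogorov) *)
Fixpoint pHn (R : realType) (x : seq nat) (n : nat) (y : seq nat) : R :=
  match n with
  | 0 => 0
  | n'.+1 =>
     if n'.+1 == size x then (if x == y then 1 else 0)
     else if (n'.+1 < size x)%N then 0
     else \sum_(z <- perms_of n') pHn R x n' z * pH R z y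
  end.

Definition pHmarg (R : realType) (y : seq nat) : R := pHn R [:: 1%N] (size y) y.

Definition KH (R : realType) (x y : seq nat) : R :=
  if (size y < size x)%N then 0 else pHn R x (size y) y / pHmarg R y.

(* Main.v *)
Require Import Defs.
From HB Require Import structures.
From mathcomp Require Import perm.
From mathcomp Require Import all_boot all_order all_algebra.
From mathcomp Require Import zify ring lra.
From mathcomp Require Import all_classical all_reals all_analysis.
From mathcomp Require Import measurable_realfun.
Set Implicit Arguments. Unset Strict Implicit. Unset Printing Implicit Defensive.
Import Order.TTheory GRing.Theory Num.Theory numFieldNormedType.Exports.

(* For i.i.d. points without ties, exchangeability makes the pattern of the first
   m points, given the permutation y of the first n, that of a uniformly random
   m-subset: P(Pi_m = x, Pi_n = y) = t(x, y) t(y, C).  Hence the backward transitions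
   do not depend on C, which gives the Markov property, and for y in S_C the
   functions f_x of the Doob-Martin compactification are the pattern frequencies
   t(x, .); for x outside S_C these vanish on S_C.  The chain of double insertions
   has the same backward transitions and uniform marginals, so its Martin kernel is
   K(x, y) = |x|! t(x, y), with boundary values |x|! t(x, C).  That C is in the
   closure of the permutations follows from a second moment bound: two uniformly
   random k-subsets of [n] meet with probability at most k^2 / n, so the variance of
   t(x, Pi_n) is at most |x|^2 / n. *)

Local Open Scope nat_scope.

(** * Patterns and double insertion *)

(** Two obstacles shape the proof. In the presence of ties [assoc_perm] need be neither a
    permutation nor symmetric in the points, so identities about points are used on [no_ties] only;
    this event has probability one because uniform marginals have no atoms. Moreover [tcop] is an
    iterated integral with no built-in relation to [P]. Recognizing the joint law of one point and
    the later ones as a product measure shows at once that [tcop] gives the law of [Pi] and that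
    probabilities see only the number of indices, which is exchangeability. The Markov property asks
    for more than laws at two times: an arbitrary event that is symmetric in the first n points is
    carried through an induction along the past, which splits off as a factor and cancels in the
    quotient. To approximate C, a deterministic sequence of permutations is enough, so averaging
    replaces almost sure convergence: some permutation deviates no more than the mean. *)

Lemma same_patternP (a b : seq nat) :
  reflect (size a = size b /\ forall i j, i < size a -> j < size a ->
             (nth 0 a i < nth 0 a j) = (nth 0 b i < nth 0 b j))
          (same_pattern a b).
Proof.
apply: (iffP andP) => [[/eqP sab /forallP H]|[sab H]].
  split=> // i j ia ja.
  by move/forallP: (H (Ordinal ia)) => /(_ (Ordinal ja)) /eqP.
split; first exact/eqP.
by apply/forallP => i; apply/forallP => j; rewrite H.
Qed.

Lemma same_pattern_refl : reflexive same_pattern.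
Proof. by move=> a; apply/same_patternP. Qed.

Lemma same_pattern_sym : symmetric same_pattern.
Proof.
by move=> a b; apply/idP/idP => /same_patternP[sab H];
  apply/same_patternP; split=> // i j ia ja; rewrite H ?sab // -sab.
Qed.

Lemma same_pattern_trans : transitive same_pattern.
Proof.
move=> b a c /same_patternP[sab Hab] /same_patternP[sbc Hbc].
apply/same_patternP; split; first by rewrite sab.
by move=> i j ia ja; rewrite Hab // Hbc // -sab.
Qed.

Lemma same_pattern_map (T : eqType) (f g : T -> nat) (s : seq T) :
  {in s &, forall x y, (f x < f y) = (g x < g y)} ->
  same_pattern (map f s) (map g s).
Proof.
move=> fg; apply/same_patternP; rewrite !size_map; split=> // i j si sj.
case: s fg si sj => // x0 s fg si sj.
by rewrite !(nth_map x0) // fg // mem_nth.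
Qed.

Lemma same_patternr a b c : same_pattern b c -> same_pattern a b = same_pattern a c.
Proof.
move=> bc; apply/idP/idP => H; first exact: same_pattern_trans bc.
by apply: same_pattern_trans H _; rewrite same_pattern_sym.
Qed.

(** Kept general in the order and the key [f], so that it covers entries of a permutation ([id]) as
    well as both coordinates of points: [rank_x] and [rank_y] are convertible to its instances at
    [fst] and [snd]. *)
Definition rank d (T : Type) (U : orderType d) (f : T -> U) (s : seq T) (x : T) :=
  count (fun y => (f y <= f x)%O) s.

Lemma rank_lt d (T : eqType) (U : orderType d) (f : T -> U) (s : seq T) (x y : T) :
  y \in s -> (rank f s x < rank f s y) = (f x < f y)%O.
Proof.
move=> ys; apply/idP/idP => [|xy].
  rewrite ltNge; apply: contraL => yx; rewrite -leqNgt.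
  by apply: sub_count => z /= /le_trans; apply.
have -> : rank f s y = rank f s x +
    count (fun z => (f x < f z)%O && (f z <= f y)%O) s.
  rewrite /rank -count_predUI.
  rewrite [X in _ = _ + X](eq_count (a2 := pred0)) ?count_pred0 ?addn0; last first.
    by move=> z /=; case: leP.
  apply: eq_count => z /=; case: (leP (f z) (f x)) => //= zx.
  by rewrite (le_trans zx) // ltW.
rewrite -[X in X < _]addn0 ltn_add2l -has_count.
by apply/hasP; exists y => //=; rewrite xy lexx.
Qed.

(** By [rank_lt] the ranks are distinct, and they lie between 1 and the length; a pigeonhole
    argument then shows that every value is taken. *)
Lemma rank_perm d (T : eqType) (U : orderType d) (f : T -> U) (s : seq T) :
  uniq (map f s) -> perm_eq (map (rank f s) s) (iota 1 (size s)).
Proof.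
have -> : map (rank f s) s = map (rank id (map f s)) (map f s).
  by rewrite -map_comp; apply: eq_map => x /=; rewrite /rank count_map.
rewrite -(size_map f s); move: (map f s) => {f}s us.
have uS : uniq (map (rank id s) s).
  rewrite map_inj_in_uniq // => x y xs ys exy.
  apply/eqP; case: (ltgtP x y) => //.
    by rewrite -(rank_lt id (s := s)) // exy ltnn.
  by rewrite -(rank_lt id (s := s)) // exy ltnn.
apply: uniq_perm => //; first exact: iota_uniq.
apply: (uniq_min_size uS _ _).2; last by rewrite size_map size_iota.
move=> _ /mapP[x xs ->]; rewrite mem_iota add1n ltnS count_size andbT -has_count.
by apply/hasP; exists x => //=.
Qed.

Definition standardize (s : seq nat) : seq nat := map (rank id s) s.

Lemma same_pattern_std s : same_pattern s (standardize s).
Proof.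
rewrite -[X in same_pattern X]map_id; apply: same_pattern_map => x y xs ys.
by rewrite rank_lt.
Qed.

Lemma is_perm_size n s : is_perm n s -> size s = n.
Proof. by case/andP => _ /perm_size; rewrite size_iota. Qed.

Lemma is_perm_in_S n s : is_perm n s -> in_S s.
Proof. by move=> ps; rewrite /in_S (is_perm_size ps). Qed.

Lemma std_is_perm s : 0 < size s -> uniq s -> is_perm (size s) (standardize s).
Proof. by move=> s0 us; rewrite /is_perm s0 rank_perm // map_id. Qed.

Lemma std_perm n s : is_perm n s -> standardize s = s.
Proof.
case/andP => n0 ps; rewrite /standardize -[RHS]map_id; apply/eq_in_map => x.
rewrite (perm_mem ps) mem_iota add1n ltnS => /andP[x0 xn].
rewrite /rank (permP ps) -(subnKC xn) iotaD count_cat.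
rewrite (@eq_in_count _ _ predT) => [|z]; last first.
  by rewrite mem_iota leEnat /=; lia.
rewrite count_predT size_iota (@eq_in_count _ _ pred0) ?count_pred0 ?addn0 //.
by move=> z; rewrite mem_iota leEnat /=; lia.
Qed.

Lemma count_nth (T : Type) (x0 : T) (p : pred T) (s : seq T) :
  count p s = count (fun i => p (nth x0 s i)) (iota 0 (size s)).
Proof. by rewrite -[in LHS](mkseq_nth x0 s) /mkseq count_map. Qed.

Lemma same_pattern_std_eq a b : same_pattern a b -> standardize a = standardize b.
Proof.
case/same_patternP => sab H.
apply: (@eq_from_nth _ 0) => [|i]; first by rewrite !size_map.
rewrite size_map => ia; rewrite !(nth_map 0) -?sab // /rank.
rewrite (count_nth 0 _ a) (count_nth 0 _ b) -sab.
apply: eq_in_count => j; rewrite mem_iota /= add0n => ja.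
by rewrite !leEnat leqNgt H // -leqNgt.
Qed.

(** Standardization depends on the pattern only and fixes permutations. *)
Lemma same_pattern_perm n a b : is_perm n a -> is_perm n b ->
  same_pattern a b = (a == b).
Proof.
move=> pa pb; apply/idP/eqP => [/same_pattern_std_eq|->]; last exact: same_pattern_refl.
by rewrite (std_perm pa) (std_perm pb).
Qed.

(** * Counting sublists of given length *)

(** The predicate is arbitrary because the recursion on the list replaces [Q] by [Q \o cons a], and
    because the same count serves for entries of permutations and for points in the plane. *)
Definition mask_count (T : Type) (Q : pred (seq T)) (k : nat) (s : seq T) : nat :=
  \sum_(m : (size s).-tuple bool) ((count id m == k) && Q (mask m s)).

Lemma sum_tuple_cons n (F : n.+1.-tuple bool -> nat) :
  \sum_m F m = \sum_(m : n.-tuple bool) (F [tuple of true :: m] + F [tuple of false :: m]).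
Proof.
rewrite (reindex (fun p : bool * n.-tuple bool => [tuple of p.1 :: p.2])) /=; last first.
  exists (fun m => (thead m, [tuple of behead m])) => [[b m] _|m _] /=.
    by congr pair; apply/val_inj.
  by rewrite [RHS]tuple_eta.
rewrite -(pair_bigA _ (fun (b : bool) (m : n.-tuple bool) => F [tuple of b :: m])) big_bool /=.
by rewrite big_split.
Qed.

Lemma eq_mask_count (T : Type) (Q Q' : pred (seq T)) k s : Q =1 Q' -> mask_count Q k s = mask_count Q' k s.
Proof. by move=> QQ; rewrite /mask_count; apply: eq_bigr => m _; rewrite QQ. Qed.

Lemma mask_count_nil (T : Type) (Q : pred (seq T)) k : mask_count Q k [::] = (k == 0) && Q [::].
Proof.
rewrite /mask_count (big_pred1 [tuple]) => [|m]; last by rewrite [m]tuple0 /= eqxx.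
by rewrite mask0 /= [0 == k]eq_sym.
Qed.

Lemma mask_count_cons (T : Type) (Q : pred (seq T)) k a s :
  mask_count Q k (a :: s) = (if k is k'.+1 then mask_count (Q \o cons a) k' s else 0) + mask_count Q k s.
Proof.
rewrite /mask_count sum_tuple_cons big_split /=; congr addn.
case: k => [|k]; first by rewrite big1.
by rewrite /mask_count; apply: eq_bigr => m _; rewrite add1n eqSS.
Qed.

Lemma mask_count_gt (T : Type) (Q : pred (seq T)) k s : size s < k -> mask_count Q k s = 0.
Proof.
move=> sk; rewrite /mask_count big1 // => m _; case: eqP => // mk.
by have := count_size id m; rewrite mk size_tuple leqNgt sk.
Qed.

Lemma cnt0 (T : Type) (Q : pred (seq T)) s : mask_count Q 0 s = Q [::].
Proof. by elim: s => [|a s IH]; rewrite ?mask_count_nil // mask_count_cons IH. Qed.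

Lemma mask_count_bin (T : Type) k (s : seq T) : mask_count predT k s = 'C(size s, k).
Proof.
elim: s k => [|a s IH] [|k]; rewrite ?mask_count_nil ?cnt0 ?bin0 // mask_count_cons.
by rewrite (eq_mask_count _ _ (Q' := predT)) // !IH binS addnC.
Qed.

Definition del (T : Type) (i : nat) (s : seq T) := take i s ++ drop i.+1 s.

Lemma size_del (T : Type) i (s : seq T) : i < size s -> size (del i s) = (size s).-1.
Proof. by move=> si; rewrite size_cat size_take size_drop si; lia. Qed.

(** Double counting: a k-subset of the positions survives exactly the deletions of the [size s - k]
    positions outside it. *)
Lemma mask_count_del (T : Type) (Q : pred (seq T)) k s :
  \sum_(i < size s) mask_count Q k (del i s) = (size s - k) * mask_count Q k s.
Proof.
elim: s k Q => [|a s IH] k Q; first by rewrite big_ord0 sub0n mul0n.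
rewrite /= big_ord_recl /= {1}/del /= drop0.
rewrite (eq_bigr (fun i : 'I_(size s) => (if k is k'.+1 then mask_count (Q \o cons a) k' (del i s) else 0) + mask_count Q k (del i s))); last first.
  by move=> i _; rewrite -mask_count_cons.
rewrite big_split /= IH mask_count_cons; case: k => [|k].
  by rewrite big1 //= !subn0 !add0n mulSn.
rewrite IH subSS; have [ks|sk] := leqP k.+1 (size s).
  have -> : size s - k = (size s - k.+1).+1 by lia.
  nia.
by rewrite (mask_count_gt _ sk); nia.
Qed.

Lemma mask_count_full (T : Type) (Q : pred (seq T)) s : mask_count Q (size s) s = Q s.
Proof.
elim: s Q => [|a s IH] Q; first by rewrite mask_count_nil.
by rewrite mask_count_cons /= IH mask_count_gt // addn0.
Qed.

Lemma mask_count_pred (T : Type) (Q : pred (seq T)) n s : size s = n.+1 ->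
  mask_count Q n s = \sum_(i < n.+1) Q (del i s).
Proof.
elim: n s Q => [|n IH] [|a s] // Q [sn].
  by move/size0nil: sn => ->; rewrite cnt0 big_ord_recl big_ord0 addn0.
have d0 : del (@ord0 n.+1) (a :: s) = s by rewrite /del /= drop0.
rewrite mask_count_cons big_ord_recl d0 addnC; congr addn; last by rewrite IH.
by rewrite -sn mask_count_full.
Qed.

(* [pattern_count] and [pH] take cardinals of classical sets, with membership given by [asbool]. *)
Lemma card_classical (T : finType) (p : pred T) :
  #|[set x | p x]%classic| = \sum_x p x.
Proof.
rewrite -sum1_card big_mkcond; apply: eq_bigr => x _.
have -> : (x \in [set x | p x]%classic) = p x by apply/idP/idP; rewrite inE.
by case: (p x).
Qed.

Lemma pattern_countE sigma pi : pattern_count sigma pi = mask_count (same_pattern sigma) (size sigma) pi.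
Proof. exact: card_classical. Qed.

Lemma pattern_count_std sigma pi : pattern_count sigma (standardize pi) = pattern_count sigma pi.
Proof.
rewrite !pattern_countE /mask_count /standardize size_map.
apply: eq_bigr => m _; rewrite -map_mask -[X in _ = nat_of_bool (_ && same_pattern _ X)]map_id.
congr (nat_of_bool (_ && _)); apply: same_patternr; apply: same_pattern_map => x y xm ym.
by rewrite rank_lt // (mem_mask ym).
Qed.

Lemma pattern_count_gt sigma pi : size pi < size sigma -> pattern_count sigma pi = 0.
Proof. by rewrite pattern_countE; exact: mask_count_gt. Qed.

Lemma del_subseq (T : eqType) i (s : seq T) : subseq (del i s) s.
Proof.
rewrite -[X in subseq _ X](cat_take_drop i s) cat_subseq //.
by rewrite -add1n -drop_drop drop_subseq.
Qed.

Lemma mem_perms_of n s : 0 < n -> (s \in perms_of n) = is_perm n s.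
Proof. by move=> n0; rewrite mem_permutations /is_perm n0. Qed.

(* The inserted value has to be the entry of tau at the insertion position. *)
Lemma insert_permE n sigma tau i j : is_perm n sigma -> is_perm n.+1 tau -> i < n.+1 ->
  (insert_perm sigma i.+1 j.+1 == tau) =
  (j.+1 == nth 0 tau i) && same_pattern sigma (del i tau).
Proof.
move=> ps pt iN; have sn := is_perm_size ps; have tn := is_perm_size pt.
have utau : uniq tau by case/andP: pt => _ /perm_uniq ->; exact: iota_uniq.
rewrite /insert_perm /=; set f := fun v => _.
have tauE : tau = take i tau ++ nth 0 tau i :: drop i.+1 tau.
  by rewrite -drop_nth ?tn // cat_take_drop.
rewrite [in LHS]tauE eqseq_cat; last by rewrite !size_take_min size_map sn tn; lia.
rewrite eqseq_cons andbCA; case: eqP => //= jE.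
rewrite -eqseq_cat; last by rewrite !size_take_min size_map sn tn; lia.
rewrite cat_take_drop -/(del i tau).
have fE v : f v = v + (j.+1 <= v) by rewrite /f; case: leqP; lia.
have fmono u v : (f u < f v) = (u < v) by rewrite !fE; lia.
have spf : same_pattern sigma (map f sigma).
  by rewrite -[X in same_pattern X]map_id; apply: same_pattern_map => u v _ _.
apply/eqP/idP => [<- //|sp].
(* [g] closes the gap left by the value [j.+1] and so inverts [f]. Applied to the remaining entries
   of [tau] it gives a permutation with the pattern of [sigma], hence [sigma] itself. *)
pose g v := v - (j.+1 <= v).
have ndel : nth 0 tau i \notin del i tau.
  have : perm_eq tau (nth 0 tau i :: del i tau).
    by rewrite {1}tauE (perm_catCA _ [:: nth 0 tau i]).
  by move/perm_uniq; rewrite utau => /esym/andP[].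
have mdel v : v \in del i tau -> v != j.+1 /\ 0 < v <= n.+1.
  move=> vd; split; first by apply: contraNneq ndel => vj; rewrite -jE -vj.
  have := mem_subseq (del_subseq i tau) vd.
  by case/andP: pt => _ /perm_mem ->; rewrite mem_iota; lia.
have j0 : j.+1 <= n.+1.
  have := mem_nth 0 (s := tau) (n := i); rewrite tn iN -jE => /(_ isT).
  by case/andP: pt => _ /perm_mem ->; rewrite mem_iota; lia.
have n0 : 0 < n by case/andP: ps.
have sdel : size (del i tau) = n by rewrite size_del tn.
have pg : is_perm n (map g (del i tau)).
  rewrite /is_perm n0; apply: uniq_perm; last 1 first.
  - apply: (uniq_min_size _ _ _).2; last by rewrite size_map size_iota sdel.
      rewrite map_inj_in_uniq ?(subseq_uniq (del_subseq i tau)) //.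
      by move=> u v /mdel[] + + /mdel[]; rewrite /g; lia.
    by move=> _ /mapP[v /mdel[] + + ->]; rewrite mem_iota /g; lia.
  - rewrite map_inj_in_uniq ?(subseq_uniq (del_subseq i tau)) //.
    by move=> u v /mdel[] + + /mdel[]; rewrite /g; lia.
  - exact: iota_uniq.
have : sigma = map g (del i tau).
  apply/eqP; rewrite -(same_pattern_perm ps pg).
  apply: same_pattern_trans sp _; rewrite -[X in same_pattern X]map_id.
  by apply: same_pattern_map => u v /mdel[] + + /mdel[]; rewrite /g; lia.
move=> ->; rewrite -map_comp -[RHS]map_id; apply/eq_in_map => v /mdel[] /=.
by rewrite fE /g; lia.
Qed.

(** By [insert_permE] the position determines the inserted value, so the pairs are counted by the
    positions of [tau] whose deletion leaves the pattern [sigma]. *)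
Lemma card_insert n sigma tau : is_perm n sigma -> is_perm n.+1 tau ->
  #|[set ij : 'I_n.+1 * 'I_n.+1 | insert_perm sigma ij.1.+1 ij.2.+1 == tau]%classic| =
  pattern_count sigma tau.
Proof.
move=> ps pt; rewrite pattern_countE (is_perm_size ps).
rewrite (mask_count_pred _ (is_perm_size pt)) card_classical.
rewrite (eq_bigr (fun ij : 'I_n.+1 * 'I_n.+1 => nat_of_bool (ij.2.+1 == nth 0 tau ij.1) *
    (same_pattern sigma (del ij.1 tau) : nat))); last first.
  by move=> ij _; rewrite (insert_permE _ ps pt) // mulnb.
rewrite -(pair_bigA _ (fun i j : 'I_n.+1 => nat_of_bool (j.+1 == nth 0 tau i) *
    (same_pattern sigma (del i tau) : nat))) /=.
apply: eq_bigr => i _; rewrite -big_distrl /=.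
have : nth 0 tau i \in iota 1 n.+1.
  have tn := is_perm_size pt.
  by case/andP: pt => _ /perm_mem <-; rewrite mem_nth // tn.
rewrite mem_iota add1n ltnS => /andP[t0 tN].
have lt : (nth 0 tau i).-1 < n.+1 by lia.
rewrite (bigD1 (Ordinal lt)) //= prednK // eqxx big1 ?addn0 ?mul1n // => j.
by rewrite -val_eqE /= -(eqn_add2r 1) !addn1 prednK // => /negbTE ->.
Qed.

(** * Kernels of the chain of double insertions *)

Local Open Scope ring_scope.

Lemma pHE (R : realType) n sigma tau : is_perm n sigma -> is_perm n.+1 tau ->
  pH R sigma tau = (pattern_count sigma tau)%:R / (n.+1 ^ 2)%:R.
Proof. by move=> ps pt; rewrite -(card_insert ps pt) /pH (is_perm_size ps). Qed.

Lemma pattern_count_same n x y : is_perm n x -> is_perm n y ->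
  pattern_count x y = (x == y).
Proof.
move=> px py; rewrite pattern_countE (is_perm_size px) -(same_pattern_perm px py).
by rewrite -{1}(is_perm_size py) mask_count_full.
Qed.

Lemma tpatE (R : realType) x y : tpat R x y = (pattern_count x y)%:R / 'C(size y, size x)%:R.
Proof. by rewrite /tpat; case: ltnP => // h; rewrite pattern_count_gt // mul0r. Qed.

(** The factor is the quotient of the uniform marginals [1/n!] and [1/m!], as in Bayes' formula. In
    the induction the last insertion is undone by deleting one entry of [y], and [mask_count_del]
    sums the pattern counts over all deletions. *)
Lemma pHnE (R : realType) m n x y : is_perm m x -> is_perm n y -> (m <= n)%N ->
  pHn R x n y = m`!%:R / n`!%:R * tpat R x y.
Proof.
move=> px py mn; have m0 : (0 < m)%N by case/andP: px.
rewrite -(subnKC mn) in py *; move: (n - m)%N py => {mn}k.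
elim: k y => [|k IH] y py.
  rewrite addn0 in py *; rewrite tpatE (pattern_count_same px py).
  rewrite (is_perm_size px) (is_perm_size py) binn divr1 divff ?pnatr_eq0 -?lt0n ?fact_gt0 //.
  rewrite mul1r; case: m m0 px {py} => // m _ /is_perm_size sx /=.
  by rewrite sx eqxx; case: eqP.
rewrite addnS in py *; rewrite /= (is_perm_size px) gtn_eqF; last by rewrite ltnS leq_addr.
rewrite ltnNge (leq_trans (leq_addr k m)) //=.
have mk0 : (0 < m + k)%N by rewrite addn_gt0 m0.
rewrite big_seq.
(* Each last step from [z] to [y] is split according to the deleted position [i]. After exchanging
   the sums, only [z = standardize (del i y)] contributes for given [i]. *)
rewrite (eq_bigr (fun z => \sum_(i < (m + k).+1)
   (m`!%:R / (m + k)`!%:R / 'C(m + k, m)%:R / ((m + k).+1 ^ 2)%:R) *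
   ((pattern_count x z)%:R * (z == standardize (del i y))%:R))); last first.
  move=> z; rewrite mem_perms_of // => pz.
  rewrite IH // (pHE _ pz py) tpatE (is_perm_size px) (is_perm_size pz).
  rewrite (pattern_countE z) (is_perm_size pz) (mask_count_pred _ (is_perm_size py)).
  rewrite natr_sum -mulr_sumr -mulr_sumr.
  rewrite (eq_bigr (fun i : 'I_(m + k).+1 => (z == standardize (del i y))%:R)); last first.
    move=> i _; rewrite (same_patternr _ (same_pattern_std _)).
    rewrite (same_pattern_perm pz) //.
    have sd : size (del i y) = (m + k)%N by rewrite size_del (is_perm_size py).
    rewrite -{1}sd; apply: std_is_perm; first by rewrite sd.
    apply: subseq_uniq (del_subseq _ _) _.
    by case/andP: py => _ /perm_uniq ->; exact: iota_uniq.
  by rewrite -!mulrA; do 2 congr (_ * _); rewrite !mulrA [in RHS]mulrC !mulrA; ring.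
rewrite exchange_big /=.
under eq_bigr => i _ do rewrite -mulr_sumr.
rewrite -mulr_sumr.
rewrite (eq_bigr (fun i : 'I_(m + k).+1 => (pattern_count x (del i y))%:R)); last first.
  move=> i _; have sd : size (del i y) = (m + k)%N by rewrite size_del (is_perm_size py).
  have pd : is_perm (m + k) (standardize (del i y)).
    rewrite -{1}sd; apply: std_is_perm; first by rewrite sd.
    apply: subseq_uniq (del_subseq _ _) _.
    by case/andP: py => _ /perm_uniq ->; exact: iota_uniq.
  rewrite -big_seq (bigD1_seq (standardize (del i y))) ?permutations_uniq //=; last first.
    by rewrite mem_perms_of.
  rewrite eqxx mulr1 pattern_count_std big1 ?addr0 // => z /negbTE ->.
  by rewrite mulr0.
rewrite -natr_sum; have := mask_count_del (same_pattern x) (size x) y.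
rewrite (is_perm_size py) (is_perm_size px) => HH.
rewrite (eq_bigr (fun i : 'I_(m + k).+1 => mask_count (same_pattern x) m (del i y))); last first.
  by move=> i _; rewrite pattern_countE (is_perm_size px).
rewrite HH tpatE (is_perm_size py) (is_perm_size px) pattern_countE (is_perm_size px).
have bm : ((m + k).+1 * 'C(m + k, m) = ((m + k).+1 - m) * 'C((m + k).+1, m))%N.
  by rewrite -mul_bin_down.
have nz j : (0 < j)%N -> (j%:R != 0 :> R) by rewrite pnatr_eq0 -lt0n.
have Dr : ((m + k).+1 - m)%:R = (m + k).+1%:R * 'C(m + k, m)%:R / 'C((m + k).+1, m)%:R :> R.
  apply: (canRL (mulfK _)); first by rewrite nz // bin_gt0; lia.
  by rewrite -!natrM bm.
rewrite natrM Dr factS natrX natrM; field.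
by rewrite -!natrD nat1r !nz ?fact_gt0 ?bin_gt0 //; lia.
Qed.

(** The marginal is [pHnE] started at the permutation of length one, whose frequency in [y] is 1; it
    equals [1/n!] with [n] the length of [y], which cancels the same factor in the n-step kernel. *)
Lemma KHE (R : realType) x y : in_S x -> in_S y -> KH R x y = (size x)`!%:R * tpat R x y.
Proof.
move=> px py; rewrite /KH; case: ltnP => [yx|xy]; first by rewrite /tpat yx mulr0.
have p1 : is_perm 1 [:: 1%N] by [].
have y0 : (0 < size y)%N by case/andP: py.
have t1 : tpat R [:: 1%N] y = 1.
  rewrite tpatE pattern_countE bin1 (_ : mask_count _ _ _ = size y) ?divff ?pnatr_eq0 -?lt0n //.
  rewrite -[RHS]bin1 -mask_count_bin /mask_count; apply: eq_bigr => m _.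
  case: eqP => //= m1; rewrite (_ : same_pattern _ _ = true) //; apply/same_patternP.
  by split=> [|[|i] [|j] //=]; rewrite ?ltnn // size_mask ?size_tuple.
rewrite /pHmarg (pHnE R px py xy) (pHnE R p1 py y0) t1 mulr1 factS fact0 muln1 div1r invrK.
by rewrite mulrAC divfK // pnatr_eq0 -lt0n fact_gt0.
Qed.
Local Open Scope ring_scope.

(** Frees the tuple length from [size s], so that lists of equal length can be summed over the same
    type of masks. *)
Lemma mask_countE (T : Type) (Q : pred (seq T)) k n s : size s = n ->
  mask_count Q k s = (\sum_(m : n.-tuple bool) ((count id m == k) && Q (mask m s)))%N.
Proof. by move=> <-. Qed.

Lemma mask_map (I T : Type) (f : I -> bool) (g : I -> T) (r : seq I) :
  mask (map f r) (map g r) = map g [seq i <- r | f i].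
Proof. by elim: r => //= i r ->; case: (f i). Qed.

(** The symmetry of [Q] is required on sublists of [s] only, since [assoc_perm] is known to be
    symmetric only for points without ties. *)
Lemma mask_count_perm (T : eqType) (Q : pred (seq T)) k (s s' : seq T) : perm_eq s s' ->
  (forall m a, perm_eq (mask m s) a -> Q a = Q (mask m s)) ->
  mask_count Q k s' = mask_count Q k s.
Proof.
move=> ss' HQ; have sz := perm_size ss'.
rewrite (mask_countE _ _ (n := size s)) // (mask_countE _ _ (n := size s)) //.
have szT : size s' == size s by rewrite sz.
pose t := in_tuple s; pose t' := Tuple szT.
have : perm_eq t' t by rewrite perm_sym.
case/tuple_permP => p /= s'E.
(* The i-th entry of [s'] is entry [p i] of [s], so [phi m] selects from [s'] the same entries as
   [m] from [s], in another order. *)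
pose phi (m : (size s).-tuple bool) := [tuple tnth m (p i) | i < size s].
have phi_inj : injective phi.
  move=> m1 m2 /(congr1 (fun u : (size s).-tuple bool => tnth u)) e; apply: eq_from_tnth => i.
  by have := congr1 (fun g => g ((p^-1)%g i)) e; rewrite /= !tnth_mktuple permKV.
rewrite (reindex_inj phi_inj) /=; apply: eq_bigr => m _.
pose r := enum 'I_(size s).
have mE : tval m = map (tnth m) r by rewrite map_tnth_enum.
have pr : perm_eq (map p r) r.
  apply: uniq_perm; rewrite ?(map_inj_uniq perm_inj) ?enum_uniq // => i.
  by rewrite mem_enum; apply/mapP; exists ((p^-1)%g i); rewrite ?mem_enum ?permKV.
have phiE : tval (phi m) = map (tnth m) (map p r) by rewrite -map_comp.
have sE : s = map (tnth t) r by rewrite map_tnth_enum.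
have s'r : s' = map (tnth t) (map p r) by rewrite s'E; exact: map_comp.
rewrite phiE s'r mask_map {1}mE (permP (perm_map _ pr)); congr (nat_of_bool (_ && _)).
have msE : mask m s = map (tnth t) [seq i <- r | tnth m i].
  by rewrite -mask_map -mE -sE.
by apply: HQ; rewrite msE perm_map // perm_filter // perm_sym.
Qed.

(** * Patterns of points in the plane *)

Section Points.
Variable R : realType.
Implicit Types (pts : seq (R * R)) (p q : R * R).

Definition ties_free pts := uniq (map fst pts) && uniq (map snd pts).

Lemma ties_free_perm pts pts' : perm_eq pts pts' -> ties_free pts = ties_free pts'.
Proof. by move=> pp; rewrite /ties_free !(perm_uniq (perm_map _ pp)). Qed.

Lemma ties_free_mask m pts : ties_free pts -> ties_free (mask m pts).
Proof.
by case/andP => u1 u2; rewrite /ties_free !map_mask !mask_uniq.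
Qed.

Lemma rank_x_inj pts : ties_free pts -> {in pts &, injective (rank_x pts)}.
Proof.
case/andP => u1 _ p q pp qp e.
have e1 : p.1 = q.1.
  apply/eqP; case: (ltgtP p.1 q.1) => //;
  by rewrite -(rank_lt fst (s := pts)) // /rank -![count _ _]/(rank_x pts _) e ltnn.
have ip : (index p pts < size pts)%N by rewrite index_mem.
have iq : (index q pts < size pts)%N by rewrite index_mem.
rewrite -(nth_index (0, 0) pp) -(nth_index (0, 0) qp); congr nth; apply/eqP.
rewrite -(nth_uniq 0 _ _ u1) ?size_map // !(nth_map (0, 0)) //.
by rewrite !nth_index // e1.
Qed.

Lemma nth_find_rank_x pts q : ties_free pts -> q \in pts ->
  nth (0, 0) pts (find (fun p => rank_x pts p == rank_x pts q) pts) = q.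
Proof.
move=> tf qp; have h : has (fun p => rank_x pts p == rank_x pts q) pts.
  by apply/hasP; exists q.
apply: (rank_x_inj tf) => //; first by rewrite mem_nth // -has_find.
by apply/eqP; exact: (nth_find (0, 0) h).
Qed.

(** Without ties exactly one point has a given x-rank, so [find] leads to the same point in every
    ordering of the list. *)
Lemma assoc_perm_perm pts pts' : ties_free pts -> perm_eq pts pts' ->
  assoc_perm pts = assoc_perm pts'.
Proof.
move=> tf pp; have tf' := tf; rewrite (ties_free_perm pp) in tf'.
rewrite /assoc_perm -(perm_size pp); apply/eq_in_map => i.
case/andP: (tf) => u1 _; rewrite -(perm_mem (rank_perm u1)) => /mapP[q qp ->].
have rx p : rank_x pts p = rank_x pts' p by exact: (permP pp).
have ry p : rank_y pts p = rank_y pts' p by exact: (permP pp).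
rewrite -[rank _ _ _]/(rank_x pts q) nth_find_rank_x // rx nth_find_rank_x //.
by rewrite -(perm_mem pp).
Qed.

Definition xsorted pts := sorted (fun p q => p.1 <= q.1) pts.

(** In a list sorted by x the x-ranks are [1, ..., n] in this order, so the inverse permutation in
    [assoc_perm] is the identity. *)
Lemma assoc_perm_sorted pts : ties_free pts -> xsorted pts ->
  assoc_perm pts = [seq rank_y pts p | p <- pts].
Proof.
move=> tf sp; rewrite /assoc_perm.
have -> : iota 1 (size pts) = map (rank_x pts) pts.
  apply: (sorted_eq leq_trans anti_leq) => //.
  - exact: iota_sorted.
  - apply: homo_sorted sp => p q pq.
    by apply: sub_count => z /= /le_trans; apply.
  - by rewrite perm_sym; apply: rank_perm; case/andP: tf.
by rewrite -map_comp; apply/eq_in_map => p pp /=; rewrite nth_find_rank_x.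
Qed.

Definition xsort pts := sort (fun p q => p.1 <= q.1) pts.

Lemma xsortP pts : xsorted (xsort pts).
Proof. by apply: sort_sorted => p q; exact: le_total. Qed.

Lemma assoc_perm_is_perm pts : ties_free pts -> (0 < size pts)%N ->
  is_perm (size pts) (assoc_perm pts).
Proof.
move=> tf s0; have pp : perm_eq pts (xsort pts) by rewrite perm_sym perm_sort.
rewrite (assoc_perm_perm tf pp) assoc_perm_sorted ?xsortP -?(ties_free_perm pp) //.
rewrite /is_perm s0 (perm_size pp); apply: rank_perm.
by rewrite (ties_free_perm pp) in tf; case/andP: tf.
Qed.

Lemma size_assoc_perm pts : size (assoc_perm pts) = size pts.
Proof. by rewrite size_map size_iota. Qed.

(** Sublists of a sorted list are sorted, so both sides deal with lists of y-ranks, taken among all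
    points or among the selected ones. Either kind of rank compares like the y-coordinates. *)
Lemma assoc_perm_mask k sigma m pts : ties_free pts -> xsorted pts ->
  is_perm k sigma -> size m = size pts ->
  (count id m == k) && same_pattern sigma (mask m (assoc_perm pts)) =
  (count id m == k) && (assoc_perm (mask m pts) == sigma).
Proof.
move=> tf sp ps sm; case: eqP => //= mk.
have tfm := ties_free_mask m tf.
have sk : size (mask m pts) = k by rewrite size_mask.
have spm : xsorted (mask m pts).
  by apply: subseq_sorted sp; rewrite ?mask_subseq // => p q r; exact: le_trans.
have k0 : (0 < k)%N by case/andP: ps.
have pm : is_perm k (assoc_perm (mask m pts)).
  by rewrite -{1}sk; apply: assoc_perm_is_perm; rewrite ?sk.
rewrite [RHS]eq_sym -(same_pattern_perm ps pm) !assoc_perm_sorted // -map_mask.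
apply: same_patternr; apply: same_pattern_map => p q pm' qm.
by rewrite !(rank_lt snd) // (mem_mask qm).
Qed.

(** Links subsets of the sample, in order of observation, to subsets of positions of its
    permutation. The two agree literally for points sorted by x, and [mask_count_perm] permits the
    sorting. *)
Lemma pattern_count_assoc pts sigma : ties_free pts -> in_S sigma ->
  mask_count (fun s => assoc_perm s == sigma) (size sigma) pts =
  pattern_count sigma (assoc_perm pts).
Proof.
move=> tf ps; have pp : perm_eq pts (xsort pts) by rewrite perm_sym perm_sort.
rewrite (assoc_perm_perm tf pp) pattern_countE.
rewrite -(mask_count_perm _ pp); last first.
  by move=> m a pa; rewrite (assoc_perm_perm _ pa) // ties_free_mask.
rewrite (ties_free_perm pp) in tf; rewrite [RHS](mask_countE _ _ (size_assoc_perm _)).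
by apply: eq_bigr => m _; rewrite (assoc_perm_mask tf (xsortP _) ps) ?size_tuple.
Qed.

End Points.
Local Open Scope classical_set_scope.
Local Open Scope ring_scope.

(** * Events on finitely many i.i.d. points *)

Section Boxes.
Context d (T : measurableType d) (n : nat).

Definition boxes : set (set (n.-tuple T)) :=
  [set A | exists2 B : 'I_n -> set T, (forall i, measurable (B i)) &
           A = [set t | forall i, B i (tnth t i)]].

Lemma measurable_box (B : 'I_n -> set T) : (forall i, measurable (B i)) ->
  measurable [set t : n.-tuple T | forall i, B i (tnth t i)].
Proof.
move=> mB.
rewrite (_ : [set t | _] = \bigcap_(i in [set: 'I_n]) ((@tnth n T)^~ i @^-1` B i)).
  apply: fin_bigcap_measurable; first exact: finite_finset.
  move=> i _; rewrite -[X in measurable X]setTI.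
  exact: (measurable_tnth i).
by apply/seteqP; split=> t /= h i; [move=> _; exact: h | exact: (h i I)].
Qed.

Lemma measurable_boxes : @measurable _ (n.-tuple T) = <<s boxes >>.
Proof.
rewrite eqEsubset; split; apply: smallest_sub; try exact: smallest_sigma_algebra.
  move=> A bA; apply: sub_sigma_algebra; move: A bA.
  rewrite -bigcup_seq => _ [i _ [B mB <-]].
  exists (fun j => if j == i then B else setT) => [j|]; first by case: ifP.
  rewrite setTI; apply/seteqP; split=> t /= h; last by have := h i; rewrite eqxx.
  by move=> j; case: eqP => // ->.
by move=> _ [B mB ->]; exact: measurable_box.
Qed.

Lemma boxesI : setI_closed boxes.
Proof.
move=> _ _ [B1 mB1 ->] [B2 mB2 ->].
exists (fun i => B1 i `&` B2 i) => [i|]; first exact: measurableI.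
apply/seteqP; split=> t /= => [[h1 h2] i|h]; first by split.
by split=> i; case: (h i).
Qed.

Lemma boxesT : boxes setT.
Proof. by exists (fun=> setT) => //; apply/seteqP; split. Qed.

Lemma boxes_unique (R : realType) (m1 m2 : {measure set (n.-tuple T) -> \bar R}) :
  (m1 setT < +oo)%E -> (forall A, boxes A -> m1 A = m2 A) ->
  forall A, measurable A -> m1 A = m2 A.
Proof.
move=> m1oo m12 A mA.
apply: (measure_unique boxes (fun=> setT) measurable_boxes boxesI) => //.
- by move=> _; exact: boxesT.
- by rewrite bigcup_const //; exists 0%N.
Qed.

(** Both sides are finite measures in [A], the right one a multiple of the law of [f], so agreement
    on the generating pi-system of boxes suffices. *)
Lemma boxes_indep d' (O : measurableType d') (R : realType) (P : probability O R)
    (f : O -> n.-tuple T) (D : set O) : measurable_fun setT f -> measurable D ->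
  (forall A, boxes A -> P (f @^-1` A `&` D) = (P (f @^-1` A) * P D)%E) ->
  forall A, measurable A -> P (f @^-1` A `&` D) = (P (f @^-1` A) * P D)%E.
Proof.
move=> mf mD H A mA.
unshelve epose (m1 := (pushforward (mrestr P mD) f : {measure set (n.-tuple T) -> \bar R})).
  exact: mf.
unshelve epose (m2 := (pushforward P f : {measure set (n.-tuple T) -> \bar R})).
  exact: mf.
have PD0 : 0 <= fine (P D) by apply: fine_ge0.
pose m3 : {measure set (n.-tuple T) -> \bar R} := mscale (NngNum PD0) m2.
have m3E B : m3 B = (P (f @^-1` B) * P D)%E.
  by rewrite /m3 /= /mscale /= fineK ?fin_num_measure // muleC.
rewrite -m3E; apply: (@boxes_unique _ m1 m3) => // [|B /H HB]; last by rewrite m3E.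
rewrite /m1 /= /pushforward /mrestr preimage_setT setTI.
by rewrite (le_lt_trans (probability_le1 P mD)) // ltry.
Qed.

End Boxes.

Section IID.
Context (R : realType) d (Omega : measurableType d) (P : probability Omega R).
Context (X Y : nat -> Omega -> R) (C : probability (R * R)%type R).
Hypothesis iid : iid_law P X Y C.

Let Z (w : Omega) (i : nat) : R * R := (X i w, Y i w).

Lemma measurable_Z i : measurable_fun setT (Z^~ i).
Proof. by case: iid => mX [mY _]; exact: measurable_fun_pair. Qed.

(** [iid_law] speaks of initial segments; indices below [N] that are not in [idx] are given the set
    [setT] of mass one. *)
Lemma iid_seq (idx : seq nat) (B : nat -> set (R * R)) : uniq idx ->
  (forall i, measurable (B i)) ->
  P [set w | forall i, i \in idx -> B i (Z w i)] = (\prod_(i <- idx) C (B i))%E.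
Proof.
move=> ui mB; case: iid => _ [_ H].
pose N := (\max_(i <- idx) i).+1.
have iN i : i \in idx -> (i < N)%N by move=> ii; rewrite ltnS leq_bigmax_seq.
pose B' i := if i \in idx then B i else setT.
have := H N B'; rewrite (_ : [set w | _] = [set w | forall i, i \in idx -> B i (Z w i)]).
  move=> ->; last by move=> i; rewrite /B'; case: ifP.
  rewrite -(big_mkord xpredT (fun i => C (B' i))) (bigID (mem idx)) /=.
  rewrite [X in (_ * X)%E]big1 ?mule1; last first.
    by move=> i /negbTE; rewrite /B' => ->; rewrite probability_setT.
  rewrite -big_filter (eq_big_seq (fun i => C (B i))); last first.
    by move=> i; rewrite mem_filter /B' => /andP[->].
  apply: perm_big; apply: uniq_perm; rewrite ?filter_uniq ?iota_uniq // => i.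
  rewrite mem_filter mem_index_iota /=; case: (boolP (i \in idx)) => //= /iN ->.
  by [].
apply/seteqP; split=> w /= h i.
  by move=> ii; have := h i (iN i ii); rewrite /B' ii.
by move=> _; rewrite /B'; case: ifP => // ii; exact: h.
Qed.

Definition Zt n (idx : n.-tuple nat) (w : Omega) : n.-tuple (R * R) :=
  map_tuple (Z w) idx.

Lemma measurable_Zt n (idx : n.-tuple nat) : measurable_fun setT (Zt idx).
Proof.
apply/measurable_fun_tnthP => i.
rewrite (_ : _ \o _ = Z^~ (tnth idx i)); first exact: measurable_Z.
by apply/funext => w /=; rewrite tnth_map.
Qed.

Lemma Zt_box n (idx : n.-tuple nat) (A : set (n.-tuple (R * R))) :
  uniq idx -> boxes A ->
  exists2 B : nat -> set (R * R), (forall i, measurable (B i)) &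
    Zt idx @^-1` A = [set w | forall i, i \in val idx -> B i (Z w i)].
Proof.
move=> ui [B mB ->].
exists (fun j => if insub (index j idx) is Some i then B i else setT) => [j|].
  by case: insubP.
apply/seteqP; split=> w /= h.
  move=> j ji; case: insubP => //= i _ ei.
  have := h i; rewrite tnth_map (tnth_nth 0%N) /= ei nth_index //.
move=> i; rewrite tnth_map; have := h (tnth idx i) (mem_tnth _ _).
have -> : index (tnth idx i) idx = i.
  by rewrite (tnth_nth 0%N) index_uniq // size_tuple.
by case: insubP => [j _ /val_inj ->//|]; rewrite ltn_ord.
Qed.

(** [boxes_indep] is applied twice, first to reduce [A] to a box for fixed [D], then to reduce [D].
    For two boxes the claim is the product formula over the concatenated indices. *)
Lemma Zt_indep n1 n2 (idx1 : n1.-tuple nat) (idx2 : n2.-tuple nat)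
    (A : set (n1.-tuple (R * R))) (D : set (n2.-tuple (R * R))) :
  uniq (idx1 ++ idx2) -> measurable A -> measurable D ->
  P (Zt idx1 @^-1` A `&` Zt idx2 @^-1` D) = (P (Zt idx1 @^-1` A) * P (Zt idx2 @^-1` D))%E.
Proof.
move=> u12 mA mD.
have [u1 u12' u2] : [/\ uniq idx1, ~~ has (mem idx1) idx2 & uniq idx2].
  by move: u12; rewrite cat_uniq => /and3P.
have mpre n (idx : n.-tuple nat) B : measurable B -> measurable (Zt idx @^-1` B).
  by move=> mB; rewrite -[X in measurable X]setTI; exact: measurable_Zt.
apply: boxes_indep => //; first exact: measurable_Zt; first exact: mpre.
move=> {A mA} A bA.
have mA : measurable A by rewrite measurable_boxes; exact: sub_sigma_algebra.
rewrite setIC muleC; apply: boxes_indep mD => //; first exact: measurable_Zt; first exact: mpre.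
move=> {D}D bD; rewrite setIC muleC.
have [B1 mB1 E1] := Zt_box u1 bA; have [B2 mB2 E2] := Zt_box u2 bD.
rewrite E1 E2 !iid_seq //.
pose B i := if i \in val idx1 then B1 i else B2 i.
have B2E i : i \in val idx2 -> B i = B2 i.
  move=> i2; rewrite /B ifF //; apply/negP => i1; move/hasPn: u12' => /(_ i i2).
  by rewrite inE i1.
transitivity (\prod_(i <- idx1 ++ idx2) C (B i))%E.
  rewrite -iid_seq //; last by move=> i; rewrite /B; case: ifP.
  congr (P _); apply/seteqP; split=> w /=.
    move=> [h1 h2] i; rewrite mem_cat; case: (boolP (i \in val idx1)) => i1.
      by move=> _; rewrite /B i1; exact: h1.
    by move=> i2; rewrite B2E //; exact: h2.
  move=> h; split=> i ii; have := h i; rewrite mem_cat ii ?orbT => /(_ isT).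
    by rewrite /B ii.
  by rewrite B2E.
rewrite big_cat /=; congr (_ * _)%E; apply: eq_big_seq => i ii; last by rewrite B2E.
by rewrite /B ii.
Qed.

(** Predicates on lists instead of sets of tuples let [take], [drop] and rearrangements be used
    without casts between tuple types; measurability is then stated for each length separately. *)
Definition event_on (idx : seq nat) (A : pred (seq (R * R))) : set Omega :=
  [set w | A (map (Z w) idx)].

Definition measurable_event n (A : pred (seq (R * R))) : Prop :=
  measurable [set t : n.-tuple (R * R) | A t].

Lemma EvE n (idx : n.-tuple nat) A : event_on idx A = Zt idx @^-1` [set t | A (val t)].
Proof. by []. Qed.

Lemma measurable_Ev idx A : measurable_event (size idx) A -> measurable (event_on idx A).
Proof.
move=> mA; rewrite (EvE (in_tuple idx)) -[X in measurable X]setTI.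
exact: (measurable_Zt (in_tuple idx) measurableT mA).
Qed.

Lemma Pr_EvI idx1 idx2 A1 A2 : uniq (idx1 ++ idx2) ->
  measurable_event (size idx1) A1 -> measurable_event (size idx2) A2 ->
  Pr P (event_on idx1 A1 `&` event_on idx2 A2) = Pr P (event_on idx1 A1) * Pr P (event_on idx2 A2).
Proof.
move=> u mA1 mA2; rewrite /Pr -fineM ?fin_num_measure //; try exact: measurable_Ev.
by rewrite (EvE (in_tuple idx1)) (EvE (in_tuple idx2)) Zt_indep.
Qed.

Lemma P_Ev1 i (A : pred (seq (R * R))) : measurable_event 1 A ->
  measurable [set p | A [:: p]] -> P (event_on [:: i] A) = C [set p | A [:: p]].
Proof.
move=> mA mA'; have := @iid_seq [:: i] (fun=> [set p | A [:: p]]) isT (fun=> mA').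
rewrite big_seq1 => <-; congr (P _); apply/seteqP; split=> w /= h.
  by move=> j; rewrite inE => /eqP ->.
by apply: h; rewrite inE.
Qed.

End IID.

(** * Probabilities as iterated integrals, and exchangeability *)

Section IterInt.
Context (R : realType) d (Omega : measurableType d) (P : probability Omega R).
Context (X Y : nat -> Omega -> R) (C : probability (R * R)%type R).
Hypothesis iid : iid_law P X Y C.

Local Notation Ev := (event_on X Y).

Lemma measurable_cons_cst n (p : R * R) :
  measurable_fun setT (fun t : n.-tuple (R * R) => [tuple of p :: t]).
Proof. exact: measurable_cons. Qed.

Lemma measurable_event_cons n (A : pred (seq (R * R))) p : measurable_event n.+1 A -> measurable_event n (A \o cons p).
Proof.
move=> mA; rewrite /measurable_event -[X in measurable X]setTI.
exact: (measurable_cons_cst p measurableT mA).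
Qed.

(** Fubini: the first point is independent of the others, so the joint law agrees with a product
    measure on rectangles and hence everywhere. The product measure of [S] is the integral of the
    mass of its sections, to which the induction hypothesis applies. *)
Lemma Pr_Ev idx (A : pred (seq (R * R))) : uniq idx -> measurable_event (size idx) A ->
  Pr P (Ev idx A) = iter_int C (size idx) (fun l => if A l then 1 else 0).
Proof.
elim: idx A => [|i idx IH] A.
  move=> _ _ /=; rewrite /event_on /=; case: (A [::]).
    by rewrite (_ : [set _ | _] = setT) /Pr ?probability_setT //; apply/seteqP; split.
  by rewrite (_ : [set _ | _] = set0) /Pr ?measure0 //; apply/seteqP; split.
move=> ui mA; have u : uniq idx by case/andP: ui.
have -> : iter_int C (size (i :: idx)) (fun l => if A l then 1 else 0) =
    Rintegral C setT (fun p => Pr P (Ev idx (A \o cons p))).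
  by rewrite /=; congr Rintegral; apply/funext => p; rewrite IH //; exact: measurable_event_cons.
pose t := in_tuple idx.
have mZ : measurable_fun setT (fun w => (X i w, Y i w)) by exact: (measurable_Z iid i).
have mt : measurable_fun setT (Zt X Y t) by exact: (measurable_Zt iid).
pose f w := ((X i w, Y i w), Zt X Y t w).
have mf : measurable_fun setT f by exact: measurable_fun_pair.
pose Zm : {mfun Omega >-> (size idx).-tuple (R * R)} := mfun_Sub (mem_set mt).
unshelve epose (m' := (pushforward P f : {measure set _ -> \bar R})); first exact: mf.
pose S : set ((R * R) * (size idx).-tuple (R * R)) := [set q | A (q.1 :: val q.2)].
have mS : measurable S.
  rewrite -[X in measurable X]setTI.
  have mc : measurable_fun setT (fun q : (R * R) * (size idx).-tuple (R * R) =>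
      [tuple of q.1 :: q.2]) by exact: measurable_cons.
  exact: (mc measurableT _ mA).
have EE : P (Ev (i :: idx) A) = m' S by [].
rewrite /Pr EE -(@product_measure_unique _ _ _ _ _ C (distribution P Zm)) //; last first.
  move=> B D mB mD.
  pose u1 : 1.-tuple nat := [tuple i].
  have := Zt_indep iid (idx1 := u1) (idx2 := t) (A := [set v | B (thead v)]) ui _ mD.
  have mB' : measurable [set v : 1.-tuple (R * R) | B (thead v)].
    by rewrite -[X in measurable X]setTI; exact: (measurable_tnth ord0 measurableT mB).
  move=> /(_ mB') H.
  transitivity (P (Zt X Y u1 @^-1` [set v | B (thead v)] `&` Zt X Y t @^-1` D)).
    congr (P _); apply/seteqP; split=> w /=; rewrite /thead tnth_map //=.
  rewrite H; congr (_ * _)%E.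
  have := iid_seq iid (idx := [:: i]) (B := fun=> B) isT (fun=> mB).
  rewrite big_seq1 => E; apply: etrans E; congr (P _); apply/seteqP; split=> w /=; rewrite /thead tnth_map //=.
    by move=> h j; rewrite inE => /eqP ->.
  by apply; rewrite inE.
rewrite /product_measure1 /Rintegral; congr fine; apply: eq_integral => p _ /=.
rewrite fineK ?fin_num_measure //; last by apply: (measurable_Ev iid); exact: measurable_event_cons.
rewrite /distribution /pushforward /=; congr (P _).
by apply/seteqP; split=> w; rewrite /preimage /xsection /= inE.
Qed.

(** The iterated integral in [Pr_Ev] sees the indices only through their number. *)
Lemma Pr_Ev_exch idx idx' (A : pred (seq (R * R))) : uniq idx -> uniq idx' ->
  size idx = size idx' -> measurable_event (size idx) A -> Pr P (Ev idx A) = Pr P (Ev idx' A).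
Proof. by move=> u u' sz mA; rewrite !Pr_Ev -?sz. Qed.

End IterInt.

(** * Measurability of events determined by comparisons *)

Section Mtup.
Context (R : realType).
Implicit Types A B : pred (seq (R * R)).

Lemma measurable_eventI n A B : measurable_event n A -> measurable_event n B -> measurable_event n (fun z => A z && B z).
Proof.
move=> mA mB; rewrite /measurable_event (_ : [set t | _] = [set t : n.-tuple (R * R) | A t] `&` [set t : n.-tuple (R * R) | B t]).
  exact: measurableI.
by apply/seteqP; split=> t /= /andP.
Qed.

Lemma measurable_eventT n : @measurable_event R n predT.
Proof. by rewrite /measurable_event (_ : [set _ | _] = setT) //; apply/seteqP; split. Qed.

Lemma measurable_event_select n idx A : all (fun i => i < n)%N idx -> measurable_event (size idx) A ->
  measurable_event n (fun z => A [seq nth (0, 0) z i | i <- idx]).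
Proof.
move=> /allP iN mA; rewrite /measurable_event -[X in measurable X]setTI.
have mf : measurable_fun setT (fun t : n.-tuple (R * R) =>
    map_tuple (nth (0, 0) t) (in_tuple idx)).
  apply/measurable_fun_tnthP => i.
  have hi : (tnth (in_tuple idx) i < n)%N by apply: iN; exact: mem_tnth.
  rewrite (_ : _ \o _ = fun t => tnth t (Ordinal hi)); first exact: measurable_tnth.
  by apply/funext => t /=; rewrite tnth_map [RHS](tnth_nth (0, 0)).
exact: (mf measurableT _ mA).
Qed.

Lemma measurable_event_take n k A : (k <= n)%N -> measurable_event k A -> measurable_event n (fun z => A (take k z)).
Proof.
move=> kn mA.
have := @measurable_event_select n (iota 0 k) A; rewrite size_iota => /(_ _ mA) H.
have {}H : measurable_event n (fun z => A [seq nth (0, 0) z i | i <- iota 0 k]).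
  by apply: H; apply/allP => i; rewrite mem_iota /= add0n => /leq_trans; apply.
rewrite /measurable_event (_ : [set t | _] = [set t : n.-tuple (R * R) | A [seq nth (0, 0) t i | i <- iota 0 k]]) //.
by apply/seteqP; split=> t /=; rewrite map_nth_iota0 // size_tuple.
Qed.

(* The comparisons, in both coordinates, among the points and the default value (0, 0) of [nth]. *)
Definition odata n (t : n.-tuple (R * R)) : {ffun 'I_n.+1 * 'I_n.+1 -> bool * bool} :=
  [ffun ij : 'I_n.+1 * 'I_n.+1 => let p := nth (0, 0) ((0, 0) :: t) ij.1 in
              let q := nth (0, 0) ((0, 0) :: t) ij.2 in
              (p.1 <= q.1, p.2 <= q.2)].

(** Such an event is a finite union of fibres of [odata], and each fibre is a finite intersection of
    conditions on single comparisons. *)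
Lemma measurable_event_odata n A :
  (forall t t' : n.-tuple (R * R), odata t = odata t' -> A t -> A t') -> measurable_event n A.
Proof.
move=> HA; rewrite /measurable_event.
rewrite (_ : [set t | _] = \bigcup_(u in [set u | exists2 t, A (val t) & odata t = u])
   \bigcap_(ij in [set: 'I_n.+1 * 'I_n.+1])
     [set t : n.-tuple (R * R) | odata t ij = u ij]); last first.
  apply/seteqP; split=> [t At|t [_ [t' At' <-] H]] /=.
    by exists (odata t) => //; exists t.
  by apply: (HA t') => //; apply/ffunP => ij; rewrite H.
apply: fin_bigcup_measurable; first exact: finite_finset.
move=> u _; apply: fin_bigcap_measurable; first exact: finite_finset.
move=> ij _.
have mn (i : 'I_n.+1) : measurable_fun setT (fun t : n.-tuple (R * R) => nth (0, 0) ((0, 0) :: t) i).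
  case: i => -[|i] iN /=; first exact: measurable_cst.
  rewrite (_ : (fun _ => _) = fun t => tnth t (Ordinal (iN : (i < n)%N))); first exact: measurable_tnth.
  by apply/funext => t; rewrite (tnth_nth (0, 0)).
have m1 : measurable_fun setT (fun t : n.-tuple (R * R) =>
    (nth (0, 0) ((0, 0) :: t) ij.1).1 <= (nth (0, 0) ((0, 0) :: t) ij.2).1).
  by apply: measurable_fun_ler; apply: measurableT_comp (mn _).
have m2 : measurable_fun setT (fun t : n.-tuple (R * R) =>
    (nth (0, 0) ((0, 0) :: t) ij.1).2 <= (nth (0, 0) ((0, 0) :: t) ij.2).2).
  by apply: measurable_fun_ler; apply: measurableT_comp (mn _).
rewrite (_ : [set t | _] = [set t | ((nth (0, 0) ((0, 0) :: val t) ij.1).1 <= (nth (0, 0) ((0, 0) :: val t) ij.2).1) = (u ij).1]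
   `&` [set t | ((nth (0, 0) ((0, 0) :: val t) ij.1).2 <= (nth (0, 0) ((0, 0) :: val t) ij.2).2) = (u ij).2]).
  apply: measurableI.
    by rewrite -[X in measurable X]setTI; apply: (m1 measurableT [set (u ij).1]).
  by rewrite -[X in measurable X]setTI; apply: (m2 measurableT [set (u ij).2]).
apply/seteqP; split=> t /=; rewrite ffunE /=; case: (u ij) => a b /=.
  by case=> -> ->.
by case=> -> ->.
Qed.

Lemma assoc_perm_odata n (t t' : n.-tuple (R * R)) : odata t = odata t' ->
  assoc_perm t = assoc_perm t'.
Proof.
move=> tt'.
have le i j : (i < n.+1)%N -> (j < n.+1)%N ->
    ((nth (0, 0) ((0, 0) :: t) i).1 <= (nth (0, 0) ((0, 0) :: t) j).1) =
    ((nth (0, 0) ((0, 0) :: t') i).1 <= (nth (0, 0) ((0, 0) :: t') j).1) /\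
    ((nth (0, 0) ((0, 0) :: t) i).2 <= (nth (0, 0) ((0, 0) :: t) j).2) =
    ((nth (0, 0) ((0, 0) :: t') i).2 <= (nth (0, 0) ((0, 0) :: t') j).2).
  by move=> iN jN; have := congr1 (fun u : {ffun _ -> _} => u (Ordinal iN, Ordinal jN)) tt'; rewrite /= !ffunE /= => -[].
have rx i : (i < n.+1)%N -> rank_x t (nth (0, 0) ((0, 0) :: t) i) = rank_x t' (nth (0, 0) ((0, 0) :: t') i).
  move=> iN; rewrite /rank_x !(count_nth (0, 0)) !size_tuple.
  apply: eq_in_count => j; rewrite mem_iota /= add0n => jn.
  by have := le j.+1 i; rewrite ltnS jn iN => /(_ isT isT)[].
have ry i : (i < n.+1)%N -> rank_y t (nth (0, 0) ((0, 0) :: t) i) = rank_y t' (nth (0, 0) ((0, 0) :: t') i).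
  move=> iN; rewrite /rank_y !(count_nth (0, 0)) !size_tuple.
  apply: eq_in_count => j; rewrite mem_iota /= add0n => jn.
  by have := le j.+1 i; rewrite ltnS jn iN => /(_ isT isT)[].
rewrite /assoc_perm !size_tuple; apply/eq_in_map => k _.
have fE (u : n.-tuple (R * R)) : find (fun p => rank_x u p == k) u =
    find (fun i => rank_x u (nth (0, 0) u i) == k) (iota 0 n).
  by rewrite -[X in find _ X](mkseq_nth (0, 0)) /mkseq find_map size_tuple.
have -> : find (fun p => rank_x t p == k) t = find (fun p => rank_x t' p == k) t'.
  rewrite !fE; apply: eq_in_find => i; rewrite mem_iota /= add0n => iN.
  by rewrite (rx i.+1).
(* With ties a rank may be missed; then [i = n] and [nth] returns the default [(0, 0)], which sits
   at place 0 of the extended list. A genuine point [i] sits at place [i.+1]. *)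
set i := find _ _; have : (i <= n)%N by rewrite -[X in (_ <= X)%N](size_tuple t') find_size.
rewrite leq_eqVlt => /predU1P[->|iN]; last by rewrite (ry i.+1).
by rewrite !nth_default ?size_tuple // (ry 0%N).
Qed.

Definition has_perm (x : seq nat) : pred (seq (R * R)) := fun z => assoc_perm z == x.

Lemma measurable_event_has_perm n x : measurable_event n (has_perm x).
Proof. by apply: measurable_event_odata => t t' tt'; rewrite /has_perm (assoc_perm_odata tt'). Qed.

End Mtup.

Section Atoms.
Context (R : realType) (C : probability (R * R)%type R).

(** For [0 < e <= a] the level set is disjoint from [{f <= a - e}] inside [{f <= a}], so its mass is
    at most [e]. Values outside []0, 1]] are treated separately, as the law of [f] is prescribed on
    [[0, 1]]. *)
Lemma uniform_atom (f : R * R -> R) (a : R) : measurable_fun setT f ->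
  (forall a : R, 0 <= a <= 1 -> C [set p | f p <= a] = a%:E) ->
  C [set p | f p = a] = 0%E.
Proof.
move=> mf H.
have mle b : measurable [set p | f p <= b].
  rewrite -[X in measurable X]setTI.
  have h := measurable_fun_ler mf (@measurable_cst _ _ _ _ setT b).
  exact: (h measurableT [set true]).
have meq : measurable [set p | f p = a].
  by rewrite -[X in measurable X]setTI; exact: (mf measurableT [set a]).
apply/eqP; rewrite eq_le measure_ge0 andbT.
have [a1|a1] := ltP 1 a.
  rewrite (@le_trans _ _ (C (~` [set p | f p <= 1]))) //.
    apply: le_measure; rewrite ?inE //; first exact: measurableC.
    by move=> p /= ->; apply/negP; rewrite -ltNge.
  by rewrite probability_setC // H ?ler01 ?lexx // subee.
have [a0|a0] := leP a 0.
  rewrite (@le_trans _ _ (C [set p | f p <= 0])) //.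
    by apply: le_measure; rewrite ?inE // => p /= ->.
  by rewrite H ?lexx ?ler01.
have key e : 0 < e -> e <= a -> fine (C [set p | f p = a]) <= e.
  move=> e0 ea; have ae : 0 <= a - e <= 1 by lra.
  have : (C [set p | f p = a] + C [set p | (f p <= a - e)%R] <= a%:E)%E.
    rewrite -measureU //; last first.
      by apply/seteqP; split=> p //= [-> ]; lra.
    rewrite -(H a); last by lra.
    apply: le_measure; rewrite ?inE //; first exact: measurableU.
    by move=> p /= [->|]; lra.
  rewrite (H _ ae) -[X in (X + _ <= _)%E]fineK ?fin_num_measure //.
  by rewrite -EFinD lee_fin; lra.
rewrite -[leLHS]fineK ?fin_num_measure // lee_fin leNgt; apply/negP => c0.
(* A positive mass c satisfies [c <= a], so [e = c / 2] is admissible and gives [c <= c / 2]. *)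
have ca := key a a0 (lexx _).
by have := key (fine (C [set p | f p = a]) / 2) _ _; lra.
Qed.

End Atoms.

(** * Absence of ties *)

Section Exchange.
Context (R : realType) d (Omega : measurableType d) (P : probability Omega R).
Context (X Y : nat -> Omega -> R) (C : probability (R * R)%type R).
Hypothesis cop : is_copula C.
Hypothesis iid : iid_law P X Y C.

Local Notation Ev := (event_on X Y).
Local Notation Z w i := (X i w, Y i w).

(** By [Pr_Ev] the first point may be fixed; a tie then forces the second one into a level set of
    [f], which is null. *)
Lemma Pr_tie (f : R * R -> R) i j : measurable_fun setT f ->
  (forall a : R, 0 <= a <= 1 -> C [set p | f p <= a] = a%:E) -> i != j ->
  measurable [set w | f (Z w i) = f (Z w j)] /\ P [set w | f (Z w i) = f (Z w j)] = 0%E.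
Proof.
move=> mf H ij.
pose A : pred (seq (R * R)) := fun z => f (nth (0, 0) z 0) == f (nth (0, 0) z 1).
have mA : measurable_event 2 A.
  have mn (b : 'I_2) : measurable_fun setT (fun t : 2.-tuple (R * R) => f (nth (0, 0) t b)).
    apply: measurableT_comp => //.
    rewrite (_ : (fun _ => _) = fun t : 2.-tuple (R * R) => tnth t b); first exact: measurable_tnth.
    by apply/funext => t; rewrite (tnth_nth (0, 0)).
  have h (b c : 'I_2) : measurable_event 2 (fun z => f (nth (0, 0) z b) <= f (nth (0, 0) z c)).
    rewrite /measurable_event -[X in measurable X]setTI.
    have h := measurable_fun_ler (mn b) (mn c).
    exact: (h measurableT [set true]).
  have := measurable_eventI (h ord0 ord_max) (h ord_max ord0).
  rewrite /measurable_event; congr measurable.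
  by apply/seteqP; split=> t; rewrite /A /= eq_le.
have u : uniq [:: i; j] by rewrite /= inE ij.
have EE : [set w | f (Z w i) = f (Z w j)] = Ev [:: i; j] A.
  by apply/seteqP; split=> w; rewrite /event_on /A /= => /eqP.
rewrite EE; split; first exact: (measurable_Ev iid).
rewrite -[LHS]fineK ?fin_num_measure //; last exact: (measurable_Ev iid).
rewrite -[fine _]/(Pr P _) (Pr_Ev iid u mA) /=.
congr (_%:E); rewrite /Rintegral (_ : (fun _ => _) = cst 0%E) ?integral0 //.
apply/funext => p; congr (_%:E).
have mB : measurable_event 1 (A \o cons p) by exact: measurable_event_cons.
apply: etrans (esym (Pr_Ev iid (idx := [:: j]) isT mB)) _.
rewrite /Pr (P_Ev1 iid) //.
  rewrite (_ : [set _ | _] = [set q | f q = f p]) ?uniform_atom //.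
  by apply/seteqP; split=> q /=; rewrite /A /=; [move/eqP => ->|move=> ->].
rewrite (_ : [set _ | _] = f @^-1` [set f p]).
  by rewrite -[X in measurable X]setTI; exact: (mf measurableT [set f p]).
by apply/seteqP; split=> q /=; rewrite /A /=; [move/eqP => ->|move=> ->].
Qed.

Definition no_ties : set Omega :=
  [set w | forall i j, i != j -> X i w <> X j w /\ Y i w <> Y j w].

Lemma notiesP : measurable no_ties /\ P no_ties = 1%E.
Proof.
have Hx i j := @Pr_tie fst i j measurable_fst cop.2.1.
have Hy i j := @Pr_tie snd i j measurable_snd cop.2.2.
pose T i j := if i != j then [set w | X i w = X j w] `|` [set w | Y i w = Y j w] else set0.
have mT i j : measurable (T i j).
  rewrite /T; case: ifP => // ij.
  by apply: measurableU; [case: (Hx i j ij) | case: (Hy i j ij)].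
have nT i j : P.-negligible (T i j).
  rewrite /T; case: ifP => [ij|_]; last exact: negligible_set0.
  apply: negligibleU.
    by case: (Hx i j ij) => m0 P0; apply/negligibleP.
  by case: (Hy i j ij) => m0 P0; apply/negligibleP.
pose N := \bigcup_i \bigcup_j T i j.
have mN : measurable N by apply: bigcupT_measurable => i; exact: bigcupT_measurable.
have PN : P N = 0%E.
  apply: measure_negligible => //; apply: negligible_bigcup => i.
  exact: negligible_bigcup.
have -> : no_ties = ~` N.
  apply/seteqP; split=> w /= h.
    move=> [i _ [j _]]; rewrite /T; case: ifP => // ij.
    by case: (h i j ij) => h1 h2 [].
  move=> i j ij; split=> e; apply: h; exists i => //; exists j => //; rewrite /T ij; [left|right] => //.
split; first exact: measurableC.
by rewrite probability_setC // PN sube0.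
Qed.

Lemma measurable_noties : measurable no_ties. Proof. exact: notiesP.1. Qed.

Lemma Pr_noties A : measurable A -> Pr P (A `&` no_ties) = Pr P A.
Proof.
move=> mA; have [mG PG] := notiesP.
have mC := measurableC mG.
have PC : P (~` no_ties) = 0%E by rewrite probability_setC // PG subee.
rewrite /Pr -[in RHS](setUIDK A no_ties) setDE measureU //; first last.
- by rewrite setIACA setICr setI0.
- exact: measurableI.
- exact: measurableI.
rewrite [X in (_ + X)%E](_ : _ = 0%E) ?adde0 //.
apply/eqP; rewrite eq_le measure_ge0 andbT -PC; apply: le_measure; rewrite ?inE //.
exact: measurableI.
Qed.

Lemma Pr_eq_noties A B : measurable A -> measurable B ->
  (forall w, no_ties w -> A w <-> B w) -> Pr P A = Pr P B.
Proof.
move=> mA mB AB; rewrite -(Pr_noties mA) -(Pr_noties mB); congr (Pr P _).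
by apply/seteqP; split=> w [h Gw]; split=> //; apply/AB.
Qed.

Lemma ties_free_Z w idx : no_ties w -> uniq idx -> ties_free [seq Z w i | i <- idx].
Proof.
move=> Gw u; rewrite /ties_free -!map_comp !map_inj_in_uniq ?u // => i j _ _ /= e;
  apply/eqP; apply: contraT => /Gw[]; by rewrite e.
Qed.

(** Linearity of the integral: on [D], off the ties, the number of events [E j] that occur is the
    constant [c]. *)
Lemma sum_Pr_count (J : Type) (s : seq J) (E : J -> set Omega) D (c : nat) :
  measurable D -> (forall j, measurable (E j)) ->
  (forall w, no_ties w -> D w -> (\sum_(j <- s) `[< E j w >] = c)%N) ->
  \sum_(j <- s) Pr P (D `&` E j) = c%:R * Pr P D.
Proof.
move=> mD mE Hc; have mG := measurable_noties.
have mDG : measurable (D `&` no_ties) by exact: measurableI.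
rewrite -(Pr_noties mD) (eq_bigr (fun j => Pr P (E j `&` (D `&` no_ties)))); last first.
  by move=> j _; rewrite -Pr_noties; [rewrite setIAC setIC|exact: measurableI].
(* Replacing [D] by its tie-free part makes the count valid at every point of the domain of
   integration. *)
move: {Hc} (fun w (h : (D `&` no_ties) w) => Hc w h.2 h.1).
move: (D `&` no_ties) mDG => {mD mG}D mD Hc.
apply: EFin_inj; rewrite -sumEFin EFinM /Pr fineK ?fin_num_measure //.
rewrite (eq_bigr (fun j => \int[P]_(x in D) (\1_(E j) x)%:E)%E); last first.
  move=> j _; rewrite integral_indic // fineK // fin_num_measure //; exact: measurableI.
rewrite -ge0_integral_sum //; last first.
  by move=> j; apply: measurable_funTS; apply/measurable_EFinP; exact: measurable_indic.
rewrite -integral_cst //; apply: eq_integral => w; rewrite inE => Dw.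
by rewrite sumEFin -(Hc w Dw) natr_sum.
Qed.

End Exchange.

(** * Exchangeability and transition probabilities *)

Lemma perm_mask_negb (T : eqType) (m : bitseq) (s : seq T) : size m = size s ->
  perm_eq (mask m s ++ mask (map negb m) s) s.
Proof.
elim: m s => [|b m IH] [|a s] //= [sm]; have := IH s sm.
case: b => /=; first by rewrite perm_cons.
by rewrite (perm_catCA _ [:: a]) /= perm_cons.
Qed.

Lemma map_take_iota (T : Type) (f : nat -> T) k n : (k <= n)%N ->
  take k (map f (iota 0 n)) = map f (iota 0 k).
Proof. by move=> kn; rewrite -map_take take_iota (minn_idPl kn). Qed.

Section Law.
Context (R : realType) d (Omega : measurableType d) (P : probability Omega R).
Context (X Y : nat -> Omega -> R) (C : probability (R * R)%type R).
Hypothesis cop : is_copula C.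
Hypothesis iid : iid_law P X Y C.

Local Notation Ev := (event_on X Y).
Local Notation Z w i := (X i w, Y i w).
Local Notation noties := (no_ties X Y).

(** The events that are unaffected by an exchange of the first n points. Conditions on [Pi] at times
    from n on belong to them. *)
Definition head_symmetric (n : nat) (F : pred (seq (R * R))) : Prop :=
  forall z z', ties_free z -> perm_eq (take n z) (take n z') -> drop n z = drop n z' ->
    F z = F z'.

(* By exchangeability the event on the left has the same probability when the
   first m points are replaced by any m-subset of the first n points; averaging
   over all subsets produces the pattern count. *)
Lemma Pr_pattern m n N x y (F : pred (seq (R * R))) :
  is_perm m x -> size y = n -> (m <= n <= N)%N -> measurable_event N F -> head_symmetric n F ->
  Pr P (Ev (iota 0 N) (fun z => has_perm x (take m z) && (has_perm y (take n z) && F z))) =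
  tpat R x y * Pr P (Ev (iota 0 N) (fun z => has_perm y (take n z) && F z)).
Proof.
move=> px sy /andP[mn nN] mF sF.
pose B : pred (seq (R * R)) := fun z => has_perm y (take n z) && F z.
have mB : measurable_event N B by apply: measurable_eventI => //; exact: (measurable_event_take nN (measurable_event_has_perm y)).
pose A : pred (seq (R * R)) := fun z => has_perm x (take m z) && B z.
have mA : measurable_event N A by apply: measurable_eventI => //; exact: (measurable_event_take (leq_trans mn nN) (measurable_event_has_perm x)).
pose D := Ev (iota 0 N) B.
have mD : measurable D by apply: (measurable_Ev iid); rewrite size_iota.
pose s (M : n.-tuple bool) := mask M (iota 0 n).
pose E (M : n.-tuple bool) := Ev (s M) (has_perm x).
have mE M : measurable (E M) by apply: (measurable_Ev iid); exact: measurable_event_has_perm.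
have key (M : n.-tuple bool) : count id M == m -> Pr P (D `&` E M) = Pr P (Ev (iota 0 N) A).
  move=> /eqP Mm.
  pose s' := mask (map negb M) (iota 0 n).
  (* The points chosen by [M] are moved to the front, followed by the others among the first n. This
     changes the permutation of the first m points, but neither that of the first n nor the value of
     [F]. *)
  pose idx := (s M ++ s') ++ iota n (N - n).
  have pn : perm_eq (s M ++ s') (iota 0 n).
    by apply: perm_mask_negb; rewrite size_tuple size_iota.
  have szs : size (s M) = m by rewrite size_mask ?size_tuple ?size_iota.
  have szss : size (s M ++ s') = n by rewrite (perm_size pn) size_iota.
  have iotaN : iota 0 N = iota 0 n ++ iota n (N - n) by rewrite -{1}(subnKC nN) iotaD.
  have pN : perm_eq idx (iota 0 N) by rewrite iotaN perm_cat2r.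
  have uN : uniq idx by rewrite (perm_uniq pN) iota_uniq.
  have szN : size idx = N by rewrite (perm_size pN) size_iota.
  rewrite -(Pr_Ev_exch iid (idx := idx) (idx' := iota 0 N)) ?iota_uniq ?szN ?size_iota //.
  apply: (Pr_eq_noties cop iid).
  - exact: measurableI.
  - by apply: (measurable_Ev iid); rewrite szN.
  move=> w Gw; rewrite /D /E /event_on /=.
  have tfN := ties_free_Z Gw uN.
  have mapE : map (fun i => Z w i) idx =
     (map (fun i => Z w i) (s M ++ s')) ++ map (fun i => Z w i) (iota n (N - n)).
    exact: map_cat.
  have iotaE : map (fun i => Z w i) (iota 0 N) =
     (map (fun i => Z w i) (iota 0 n)) ++ map (fun i => Z w i) (iota n (N - n)).
    by rewrite iotaN; exact: map_cat.
  have tfn : ties_free (map (fun i => Z w i) (s M ++ s')).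
    by apply: ties_free_Z => //; rewrite (perm_uniq pn) iota_uniq.
  have e1 : take m [seq Z w i | i <- idx] = [seq Z w i | i <- s M].
    by rewrite /idx -catA map_cat take_size_cat // size_map.
  have e2 : has_perm y (take n [seq Z w i | i <- idx]) = has_perm y (take n [seq Z w i | i <- iota 0 N]).
    rewrite mapE iotaE take_size_cat ?size_map // take_size_cat ?size_map ?size_iota //.
    by rewrite /has_perm (assoc_perm_perm tfn (perm_map _ pn)).
  have e3 : F [seq Z w i | i <- idx] = F [seq Z w i | i <- iota 0 N].
    apply: sF => //; rewrite mapE iotaE.
      by rewrite !take_size_cat ?size_map ?size_iota //; exact: perm_map.
    by rewrite !drop_size_cat ?size_map ?size_iota.
  rewrite /A /B /= e1 e2 e3; split=> [[-> ->] //|/andP[-> ->] //].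
have szC : (\sum_(M : n.-tuple bool | count id M == m) 1 = 'C(n, m))%N.
  rewrite -[n in RHS](size_iota 0) -mask_count_bin (mask_countE _ _ (size_iota _ _)) [LHS]big_mkcond.
  by apply: eq_bigr => M _; case: eqP.
(* On [D] exactly [pattern_count x y] of the m-subsets show the pattern [x], while by [key] all
   ['C(n, m)] of them contribute the same probability. *)
have := sum_Pr_count cop iid (s := [seq M : n.-tuple bool <- enum {: n.-tuple bool} | count id M == m])
  (E := E) (D := D) (c := pattern_count x y) mD mE.
rewrite big_filter big_enum_cond /=.
rewrite (eq_bigr (fun=> Pr P (Ev (iota 0 N) A))) => [H|M]; last exact: key.
have {}H : 'C(n, m)%:R * Pr P (Ev (iota 0 N) A) = (pattern_count x y)%:R * Pr P D.
  rewrite -H => [|w Gw]; first by rewrite -szC natr_sum mulr_suml; apply: eq_bigr => M _; rewrite mul1r.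
  rewrite /D /event_on /mkset => /andP[yw _].
  rewrite big_filter big_enum_cond /= big_mkcond.
  have tf : ties_free [seq Z w i | i <- iota 0 n] by apply: ties_free_Z; rewrite ?iota_uniq.
  rewrite map_take_iota // in yw.
  rewrite -(eqP yw) -pattern_count_assoc //; last exact: is_perm_in_S px.
  rewrite (is_perm_size px) (mask_countE _ _ (n := n)) ?size_map ?size_iota //.
  apply: eq_bigr => M _; rewrite -map_mask /E /event_on /=.
  by case: eqP => //= _; congr nat_of_bool; apply/asboolP/idP.
have C0 : 'C(n, m)%:R != 0 :> R by rewrite pnatr_eq0 -lt0n bin_gt0.
apply: (mulfI C0); rewrite H tpatE sy (is_perm_size px) mulrA.
by rewrite [_ * (_ / _)]mulrC divfK.
Qed.

Lemma head_symmetricT n : head_symmetric n predT.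
Proof. by []. Qed.

Lemma head_symmetric_take m n F : (m <= n)%N -> head_symmetric n F -> head_symmetric m F.
Proof.
move=> mn sF z z' tf pz dz; apply: sF => //.
  by rewrite -(subnKC mn) !takeD dz perm_cat2r.
by rewrite -(subnK mn) -!drop_drop dz.
Qed.

Lemma head_symmetric_has_perm n y : head_symmetric n (fun z => has_perm y (take n z)).
Proof.
move=> z z' /andP[u1 u2] pz _; rewrite /has_perm (assoc_perm_perm _ pz) //.
by rewrite /ties_free !map_take !take_uniq.
Qed.

Lemma head_symmetricI n F1 F2 : head_symmetric n F1 -> head_symmetric n F2 ->
  head_symmetric n (fun z => F1 z && F2 z).
Proof. by move=> s1 s2 z z' tf pz dz; rewrite (s1 _ _ tf pz dz) (s2 _ _ tf pz dz). Qed.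

Definition path_event (h : nat -> seq nat) (n : nat) : pred (seq (R * R)) :=
  fun z => all (fun k => has_perm (h k) (take k z)) (iota 1 n).

Lemma pathS h n z : path_event h n.+1 z = path_event h n z && has_perm (h n.+1) (take n.+1 z).
Proof.
have iotaS : iota 1 n.+1 = iota 1 n ++ [:: n.+1] by rewrite -(addn1 n) iotaD addnC.
by rewrite /path_event iotaS all_cat /= andbT.
Qed.

Lemma measurable_event_path h n N : (n <= N)%N -> measurable_event N (path_event h n).
Proof.
elim: n => [|n IH] nN; first exact: measurable_eventT.
have := measurable_eventI (IH (ltnW nN)) (measurable_event_take nN (measurable_event_has_perm (h n.+1))).
by rewrite /measurable_event; congr measurable; apply/seteqP; split=> t /=; rewrite pathS.
Qed.

(* The backward transitions of a permutation sequence do not depend on C, so the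
   past only contributes a constant factor given the present. *)
Lemma Pr_path h n : (0 < n)%N -> (forall k, (0 < k <= n)%N -> is_perm k (h k)) ->
  exists q : R, forall N F, (n <= N)%N -> measurable_event N F -> head_symmetric n F ->
    Pr P (Ev (iota 0 N) (fun z => path_event h n z && F z)) =
    q * Pr P (Ev (iota 0 N) (fun z => has_perm (h n) (take n z) && F z)).
Proof.
case: n => // n _; elim: n => [|n IH] hp.
  exists 1 => N F _ _ _; rewrite mul1r; congr (Pr P _).
  by apply/seteqP; split=> w; rewrite /event_on /path_event /= andbT.
have [|q Hq] := IH; first by move=> k /andP[k0 kn]; apply: hp; rewrite k0 ltnW.
(* One more backward transition. The condition at the new time is symmetric in the earlier points,
   so it joins [F] in the induction hypothesis, and [Pr_pattern] then removes the condition at the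
   preceding time. *)
exists (q * tpat R (h n.+1) (h n.+2)) => N F nN mF sF.
have p1 : is_perm n.+1 (h n.+1) by apply: hp; rewrite /= ltnS.
have p2 : is_perm n.+2 (h n.+2) by apply: hp; rewrite /= ltnS.
rewrite -mulrA -(Pr_pattern p1 (is_perm_size p2)) ?leqnSn //.
rewrite -Hq; last first.
- apply: head_symmetric_take (leqnSn _) _; apply: head_symmetricI => //.
  exact: head_symmetric_has_perm.
- by apply: measurable_eventI => //; exact: (measurable_event_take nN (measurable_event_has_perm _)).
- exact: ltnW.
by congr (Pr P _); apply/seteqP; split=> w; rewrite /event_on /mkset (pathS h n.+1) andbA.
Qed.

Lemma Pi_has_perm n w : Pi X Y n w = assoc_perm [seq Z w i | i <- iota 0 n].
Proof. by []. Qed.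

Lemma Pr_Pi n sigma : size sigma = n -> Pr P [set w | Pi X Y n w = sigma] = tcop C sigma.
Proof.
move=> sz; rewrite /tcop -sz -[X in iter_int C X](size_iota 0).
rewrite -(Pr_Ev iid (A := has_perm sigma)) ?iota_uniq //; last exact: measurable_event_has_perm.
by congr (Pr P _); apply/seteqP; split=> w; rewrite /event_on /mkset /has_perm sz => /eqP.
Qed.

Lemma PiPr2 m n x y : is_perm m x -> size y = n -> (m <= n)%N ->
  Pr P [set w | Pi X Y m w = x /\ Pi X Y n w = y] = tpat R x y * tcop C y.
Proof.
move=> px sy mn; rewrite -(Pr_Pi sy).
have := @Pr_pattern m n n x y predT px sy; rewrite mn leqnn => /(_ isT (@measurable_eventT _ _) (@head_symmetricT _)).
have -> : Ev (iota 0 n) (fun z => has_perm x (take m z) && (has_perm y (take n z) && predT z)) =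
    [set w | Pi X Y m w = x /\ Pi X Y n w = y].
  apply/seteqP; split=> w; rewrite /event_on /mkset !map_take_iota // andbT.
    by case/andP => /eqP <- /eqP <-.
  by case=> <- <-; rewrite /has_perm !eqxx.
move=> ->; congr (_ * Pr P _).
apply/seteqP; split=> w; rewrite /event_on /mkset !map_take_iota // andbT /has_perm.
  by move/eqP.
by move=> <-; rewrite eqxx.
Qed.

Lemma Pi_is_perm n w : (0 < n)%N -> noties w -> is_perm n (Pi X Y n w).
Proof.
move=> n0 Gw; rewrite Pi_has_perm.
have := @assoc_perm_is_perm R [seq Z w i | i <- iota 0 n].
rewrite size_map size_iota; apply => //; apply: ties_free_Z => //; exact: iota_uniq.
Qed.

Lemma tpat_step n sigma tau : is_perm n sigma -> is_perm n.+1 tau ->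
  tpat R sigma tau = n.+1%:R * pH R sigma tau.
Proof.
move=> ps pt; rewrite tpatE (pHE R ps pt) (is_perm_size ps) (is_perm_size pt) binSn.
by rewrite expnS expn1 natrM; field; rewrite nat1r pnatr_eq0.
Qed.

Lemma Pi_path_transition n (h : nat -> seq nat) tau :
  is_perm n (h n) -> is_perm n.+1 tau ->
  0 < Pr P [set w | forall k, (0 < k <= n)%N -> Pi X Y k w = h k] ->
  Pr P [set w | (forall k, (0 < k <= n)%N -> Pi X Y k w = h k) /\ Pi X Y n.+1 w = tau]
  / Pr P [set w | forall k, (0 < k <= n)%N -> Pi X Y k w = h k]
  = n.+1%:R * tcop C tau / tcop C (h n) * pH R (h n) tau.
Proof.
move=> pn pt.
have n0 : (0 < n)%N by case/andP: pn.
have pathE N w : (n <= N)%N ->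
    path_event h n [seq Z w i | i <- iota 0 N] <-> forall k, (0 < k <= n)%N -> Pi X Y k w = h k.
  move=> nN; split=> [/allP H k /andP[k0 kn]|H].
    have := H k; rewrite mem_iota add1n ltnS k0 kn => /(_ isT) /eqP.
    by rewrite map_take_iota // (leq_trans kn).
  apply/allP => k; rewrite mem_iota add1n ltnS => /andP[k0 kn].
  rewrite map_take_iota ?(leq_trans kn) //; apply/eqP; rewrite -Pi_has_perm H //.
  by rewrite k0.
have E1 : [set w | forall k, (0 < k <= n)%N -> Pi X Y k w = h k] =
    Ev (iota 0 n) (fun z => path_event h n z && predT z).
  by apply/seteqP; split=> w; rewrite /event_on /mkset andbT => /pathE; exact.
have E2 : [set w | (forall k, (0 < k <= n)%N -> Pi X Y k w = h k) /\ Pi X Y n.+1 w = tau] =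
    Ev (iota 0 n.+1) (fun z => path_event h n z && has_perm tau (take n.+1 z)).
  apply/seteqP; split=> w; rewrite /event_on /mkset map_take_iota //.
    by case=> /pathE -> // <-; rewrite /has_perm eqxx.
  by move=> /andP[/pathE H /eqP <-]; split=> //; exact: H.
rewrite E1 E2 => pos.
have mp N : (n <= N)%N -> measurable_event N (path_event h n) by exact: measurable_event_path.
(* A history of positive probability contains an outcome without ties, and there every [Pi X Y k] is
   a permutation. *)
have hp k : (0 < k <= n)%N -> is_perm k (h k).
  move=> kn; have [w [Gw]] : exists w, noties w /\ Ev (iota 0 n) (fun z => path_event h n z && predT z) w.
    apply: contrapT => /forallNP no; move: pos.
    rewrite -(Pr_noties cop iid); last first.
      by apply: (measurable_Ev iid); rewrite size_iota; apply: measurable_eventI; [exact: mp|exact: measurable_eventT].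
    rewrite (_ : _ `&` _ = set0) ?/Pr ?measure0 ?ltxx //.
    by apply/seteqP; split=> w // [e Gw]; case: (no w).
  rewrite -E1 /= => H; rewrite -(H k kn); apply: Pi_is_perm => //.
  by case/andP: kn.
(* The same [q] serves for the denominator, with trivial [F], and for the numerator, where [F] is
   the condition at time [n.+1]; it cancels. *)
have [q Hq] := Pr_path n0 hp.
have sF : head_symmetric n (fun z => has_perm tau (take n.+1 z)).
  by apply: head_symmetric_take (leqnSn n) _; exact: head_symmetric_has_perm.
rewrite (Hq n predT (leqnn n) (@measurable_eventT R n) (@head_symmetricT n)) in pos *.
rewrite (Hq n.+1 _ (leqnSn n) (measurable_event_take (leqnn _) (measurable_event_has_perm tau)) sF).
have e1 : Pr P (Ev (iota 0 n) (fun z => has_perm (h n) (take n z) && predT z)) = tcop C (h n).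
  rewrite -(Pr_Pi (is_perm_size pn)); congr (Pr P _).
  by apply/seteqP; split=> w; rewrite /event_on /mkset andbT map_take_iota // /has_perm => /eqP.
have e2 : Pr P (Ev (iota 0 n.+1) (fun z => has_perm (h n) (take n z) && has_perm tau (take n.+1 z))) =
    tpat R (h n) tau * tcop C tau.
  rewrite -(PiPr2 pn (is_perm_size pt)) //; congr (Pr P _).
  apply/seteqP; split=> w; rewrite /event_on /mkset !map_take_iota // /has_perm.
    by case/andP => /eqP <- /eqP <-.
  by case=> <- <-; rewrite !eqxx.
rewrite e1 in pos *; rewrite e2 (tpat_step pn pt).
have q0 : q != 0 by apply: contraTneq pos => ->; rewrite mul0r ltxx.
have t0 : tcop C (h n) != 0 by apply: contraTneq pos => ->; rewrite mulr0 ltxx.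
by field; rewrite q0 t0.
Qed.

Lemma Pi_transition n sigma tau :
  is_perm n sigma -> 0 < tcop C sigma -> is_perm n.+1 tau ->
  Pr P [set w | Pi X Y n w = sigma /\ Pi X Y n.+1 w = tau] / Pr P [set w | Pi X Y n w = sigma]
  = n.+1%:R * tcop C tau / tcop C sigma * pH R sigma tau.
Proof.
move=> ps s0 pt.
rewrite (PiPr2 ps (is_perm_size pt)) // (Pr_Pi (is_perm_size ps)) (tpat_step ps pt).
by field; rewrite gt_eqF.
Qed.

Lemma DM_funE x y : in_S x -> in_SC C y -> DM_fun P X Y x y = tpat R x y.
Proof.
move=> px /andP[py y0]; rewrite /DM_fun; case: ltnP => [yx|xy]; first by rewrite /tpat yx.
by rewrite (PiPr2 px erefl xy) Pr_Pi // mulfK // gt_eqF.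
Qed.

Lemma tcop_ge0 sigma : 0 <= tcop C sigma.
Proof. by rewrite -(Pr_Pi erefl) /Pr fine_ge0. Qed.

(** The product of [tpat R x y] and [tcop C y] is a joint probability, bounded by [tcop C x], which
    is zero, while [tcop C y] is positive. *)
Lemma tpat_notin_SC x y : in_S x -> ~~ in_SC C x -> in_SC C y -> tpat R x y = 0.
Proof.
move=> px; rewrite /in_SC px /= -leNgt => x0 /andP[py y0].
have [yx|xy] := ltnP (size y) (size x); first by rewrite /tpat yx.
have t0 : 0 <= tpat R x y by rewrite tpatE divr_ge0.
apply/eqP; rewrite eq_le t0 andbT -(pmulr_lle0 _ y0) -(PiPr2 px erefl xy).
apply: le_trans x0; rewrite -(Pr_Pi erefl).
have mPi k s : measurable [set w | Pi X Y k w = s].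
  rewrite (_ : [set w | _] = Ev (iota 0 k) (has_perm s)).
    by apply: (measurable_Ev iid); exact: measurable_event_has_perm.
  by apply/seteqP; split=> w; rewrite /event_on /mkset /has_perm => /eqP.
have mI : measurable [set w | Pi X Y (size x) w = x /\ Pi X Y (size y) w = y].
  exact: (measurableI _ _ (mPi _ _) (mPi _ _)).
apply: fine_le; rewrite ?fin_num_measure //.
by apply: le_measure; rewrite ?inE // => w [].
Qed.

End Law.

(** * Concentration of pattern frequencies *)

Lemma mask_count_all (T : Type) (p : pred T) k s : mask_count (all p) k s = 'C(count p s, k).
Proof.
elim: s k => [|a s IH] [|k]; rewrite ?mask_count_nil ?cnt0 ?bin0 // mask_count_cons.
rewrite (eq_mask_count (Q' := fun z => p a && all p z)) // IH /=.
case: (p a) => /=; last by rewrite /mask_count big1 // => m _; rewrite andbF.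
by rewrite add1n binS addnC IH.
Qed.

Definition kmasks k n := [seq M <- enum {: n.-tuple bool} | count id (val M) == k].

Lemma sum_kmasks k n (T : Type) (Q : pred (seq T)) (s : seq T) : size s = n ->
  (\sum_(M <- kmasks k n) Q (mask M s) = mask_count Q k s)%N.
Proof.
move=> sz; rewrite big_filter big_enum_cond /= (mask_countE _ _ sz) big_mkcond.
by apply: eq_bigr => M _; case: eqP.
Qed.

(** The k-subsets avoiding [i] number ['C(n.-1, k)]; the others make up the fraction [k / n]. *)
Lemma sum_kmasks_mem k n i : (i < n)%N ->
  (n * \sum_(M <- kmasks k n) (i \in mask M (iota 0 n)) = k * 'C(n, k))%N.
Proof.
move=> iN; have sn := size_iota 0 n.
have := sum_kmasks k (fun s => i \in s) sn => ->.
have : (mask_count (fun s => i \in s) k (iota 0 n) + mask_count (all (predC1 i)) k (iota 0 n) = 'C(n, k))%N.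
  rewrite -[n in RHS]sn -mask_count_bin /mask_count -big_split /=; apply: eq_bigr => M _.
  by rewrite -has_pred1 -[all _ _]negbK -has_predC (eq_has (a2 := pred1 i)) => [|j /=];
    [case: eqP; case: has | rewrite negbK].
rewrite mask_count_all.
have -> : count (predC1 i) (iota 0 n) = n.-1.
  have := count_predC (pred1 i) (iota 0 n); rewrite sn count_uniq_mem ?iota_uniq // mem_iota iN /=.
  by rewrite -[count (predC _) _]/(count (predC1 i) _); lia.
move=> H; have := mul_bin_down n k; rewrite -H.
have [kn|nk] := leqP k n; first by nia.
move: H; rewrite (bin_small nk); lia.
Qed.

(** Union bound over a common element: each [i] lies in both subsets for the fraction [(k / n) ^ 2]
    of the pairs, and there are n choices of [i]. *)
Lemma sum_kmasks_overlap k n : (0 < n)%N ->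
  (n * \sum_(M <- kmasks k n) \sum_(M' <- kmasks k n)
     has (mem (mask M (iota 0 n))) (mask M' (iota 0 n)) <= k ^ 2 * 'C(n, k) ^ 2)%N.
Proof.
(* The additional factor n supplies one n for each of the two uses of [sum_kmasks_mem]. *)
move=> n0; rewrite -(leq_pmul2l n0).
pose c (i : nat) := (\sum_(M <- kmasks k n) (i \in mask M (iota 0 n)))%N.
apply: (@leq_trans (n * (n * \sum_(i < n) c i * c i))).
  rewrite !leq_mul2l; apply/orP; right; apply/orP; right.
  apply: (@leq_trans (\sum_(M <- kmasks k n) \sum_(M' <- kmasks k n)
     \sum_(i < n) ((i : nat) \in mask M (iota 0 n)) * ((i : nat) \in mask M' (iota 0 n)))).
    apply: leq_sum => M _; apply: leq_sum => M' _.
    case: (boolP (has _ _)) => //= /hasP[i iM' iM].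
    have iN : (i < n)%N by have := mem_mask iM; rewrite mem_iota.
    rewrite (bigD1 (Ordinal iN)) //= [X in (_ <= X * _ + _)%N](_ : _ = 1%N) ?iM' //.
    by move: iM; rewrite inE => ->.
  under eq_bigr => M _ do rewrite exchange_big /=.
  rewrite exchange_big /=; apply: leq_sum => i _.
  under eq_bigr => M _ do rewrite -big_distrr /=.
  by rewrite -big_distrl.
rewrite mulnA big_distrr /=.
rewrite (eq_bigr (fun=> k ^ 2 * 'C(n, k) ^ 2)%N) => [|i _].
  by rewrite sum_nat_const card_ord.
by rewrite mulnACA (sum_kmasks_mem k (ltn_ord i)) -!mulnn mulnACA.
Qed.

Section Moments.
Context (R : realType) d (Omega : measurableType d) (P : probability Omega R).
Context (X Y : nat -> Omega -> R) (C : probability (R * R)%type R).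
Hypothesis cop : is_copula C.
Hypothesis iid : iid_law P X Y C.

Local Notation Ev := (event_on X Y).
Local Notation Z w i := (X i w, Y i w).
Local Notation noties := (no_ties X Y).

Lemma measurable_Pi k s : measurable [set w | Pi X Y k w = s].
Proof.
rewrite (_ : [set w | _] = Ev (iota 0 k) (has_perm s)).
  by apply: (measurable_Ev iid); exact: measurable_event_has_perm.
by apply/seteqP; split=> w; rewrite /event_on /mkset /has_perm => /eqP.
Qed.

Lemma sum_Pr_Pi n A : (0 < n)%N -> measurable A ->
  \sum_(p <- perms_of n) Pr P (A `&` [set w | Pi X Y n w = p]) = Pr P A.
Proof.
move=> n0 mA; rewrite (sum_Pr_count cop iid (c := 1)) ?mul1r // => [j|w Gw _].
  exact: measurable_Pi.
have pw := Pi_is_perm n0 Gw.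
rewrite (bigD1_seq (Pi X Y n w)) ?permutations_uniq //= ?mem_perms_of //.
rewrite asboolT // big1 // => p; rewrite eq_sym => /eqP np.
by rewrite asboolF.
Qed.

Lemma sum_tcop n : (0 < n)%N -> \sum_(p <- perms_of n) tcop C p = 1.
Proof.
move=> n0; have := sum_Pr_Pi n0 measurableT.
have -> : Pr P setT = 1 by rewrite /Pr probability_setT.
move=> <-; apply: eq_big_seq => p.
rewrite mem_perms_of // => /is_perm_size pp; rewrite setTI.
by rewrite (Pr_Pi iid pp).
Qed.

Lemma sum_tcop_tpat n x : in_S x -> (size x <= n)%N ->
  \sum_(p <- perms_of n) tcop C p * tpat R x p = tcop C x.
Proof.
move=> px xn; have n0 : (0 < n)%N by apply: leq_trans xn; case/andP: px.
rewrite -(Pr_Pi iid (erefl (size x))) -(sum_Pr_Pi n0 (measurable_Pi _ _)).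
apply: eq_big_seq => p; rewrite mem_perms_of // => /is_perm_size pp.
by rewrite mulrC -(PiPr2 cop iid px pp xn).
Qed.

(** The squared pattern count counts pairs of k-subsets of the sample that both show [x]. Disjoint
    pairs are independent and give [tcop C x ^+ 2]; overlapping ones are bounded by 1 and controlled
    by [sum_kmasks_overlap]. *)
Lemma sum_tcop_tpat2 n x : in_S x -> (size x <= n)%N ->
  \sum_(p <- perms_of n) tcop C p * tpat R x p ^+ 2 <=
  tcop C x ^+ 2 + (size x ^ 2)%:R / n%:R.
Proof.
set k := size x; move=> px kn.
have n0 : (0 < n)%N by apply: leq_trans kn; case/andP: px.
pose S := kmasks k n.
pose s (M : n.-tuple bool) := mask M (iota 0 n).
pose E (M : n.-tuple bool) := Ev (s M) (has_perm x).
have mE M : measurable (E M) by apply: (measurable_Ev iid); exact: measurable_event_has_perm.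
pose N : R := 'C(n, k)%:R.
have N0 : 0 < N by rewrite ltr0n bin_gt0.
have szS : (size S = 'C(n, k))%N.
  rewrite -[n in RHS](size_iota 0) -mask_count_bin -(sum_kmasks k predT (size_iota 0 n)).
  by rewrite sum1_size.
have pw w : noties w -> (\sum_(M <- S) `[< E M w >] = pattern_count x (Pi X Y n w))%N.
  move=> Gw; rewrite Pi_has_perm -pattern_count_assoc //; last first.
    by apply: ties_free_Z => //; exact: iota_uniq.
  rewrite -(sum_kmasks _ _ (n := n)); last by rewrite size_map size_iota.
  apply: eq_bigr => M _; rewrite -map_mask; congr nat_of_bool.
  by apply/asboolP/idP.
have sumE : \sum_(p <- perms_of n) tcop C p * (pattern_count x p)%:R ^+ 2 =
    \sum_(M <- S) \sum_(M' <- S) Pr P (E M `&` E M').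
  transitivity (\sum_(p <- perms_of n) \sum_(M <- S) \sum_(M' <- S)
      Pr P ((E M `&` E M') `&` [set w | Pi X Y n w = p])).
    apply: eq_big_seq => p; rewrite mem_perms_of // => /is_perm_size pp.
    rewrite -(Pr_Pi iid pp) -natrX mulrC.
    rewrite -(sum_Pr_count cop iid (s := [seq (M, M') | M <- S, M' <- S])
       (E := fun q => E q.1 `&` E q.2)) //.
    - rewrite big_allpairs; apply: eq_bigr => M _; apply: eq_bigr => M' _.
      by rewrite setIC.
    - exact: measurable_Pi.
    - by move=> q; exact: measurableI.
    move=> w Gw /= <-; rewrite big_allpairs -(pw w Gw) -mulnn big_distrl /=.
    apply: eq_bigr => M _; rewrite big_distrr /=; apply: eq_bigr => M' _.
    rewrite mulnb; congr nat_of_bool; apply/asboolP/andP.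
      by case=> h1 h2; split; apply/asboolP.
    by case=> /asboolP h1 /asboolP h2.
  rewrite exchange_big /=; apply: eq_bigr => M _.
  rewrite exchange_big /=; apply: eq_bigr => M' _.
  by rewrite sum_Pr_Pi //; exact: measurableI.
have PrE M : M \in S -> Pr P (E M) = tcop C x.
  rewrite mem_filter => /andP[/eqP Mk _].
  have sz : size (s M) = k by rewrite size_mask ?size_tuple ?size_iota.
  rewrite /E (Pr_Ev iid) ?mask_uniq ?iota_uniq //; last exact: measurable_event_has_perm.
  by rewrite sz.
have pairE M M' : M \in S -> M' \in S ->
    Pr P (E M `&` E M') <= tcop C x ^+ 2 + (has (mem (s M)) (s M'))%:R.
  move=> MS M'S; case: (boolP (has _ _)) => [_|nov].
    have : Pr P (E M `&` E M') <= 1.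
      rewrite /Pr -[1]/(fine 1%E); apply: fine_le; rewrite ?fin_num_measure //; try exact: measurableI.
      by apply: probability_le1; exact: measurableI.
    by rewrite -[true%:R]/(1 : R); have := sqr_ge0 (tcop C x); lra.
  rewrite addr0 (Pr_EvI iid); [|by rewrite cat_uniq nov !mask_uniq ?iota_uniq|exact: measurable_event_has_perm..].
  by rewrite -![Pr P (event_on _ _ _ _)]/(Pr P (E _)) !PrE.
have ovb : \sum_(M <- S) \sum_(M' <- S) (has (mem (s M)) (s M'))%:R <= (k ^ 2)%:R / n%:R * N ^+ 2 :> R.
  have := sum_kmasks_overlap k n0; rewrite -(ler_nat R) natrM natrM => H.
  rewrite mulrAC ler_pdivlMr ?ltr0n // mulrC.
  apply: le_trans _ (le_trans H _); last by rewrite [('C(n, k) ^ 2)%:R]natrX.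
  by rewrite natr_sum; under [X in _ <= _ * X]eq_bigr do rewrite natr_sum.
have main : \sum_(p <- perms_of n) tcop C p * (pattern_count x p)%:R ^+ 2 <=
    (tcop C x ^+ 2 + (k ^ 2)%:R / n%:R) * N ^+ 2.
  rewrite sumE mulrDl; apply: le_trans (lerD (lexx _) ovb).
  have -> : tcop C x ^+ 2 * N ^+ 2 = \sum_(M <- S) \sum_(M' <- S) tcop C x ^+ 2.
    rewrite !big_const_seq !count_predT !iter_addr_0 szS -mulrnA.
    by rewrite -[RHS]mulr_natr natrM expr2.
  rewrite -big_split /= [leLHS]big_seq [leRHS]big_seq; apply: ler_sum => M MS.
  by rewrite -big_split /= [leLHS]big_seq [leRHS]big_seq; apply: ler_sum => M' M'S; exact: pairE.
rewrite -(ler_pM2r (exprn_gt0 2 N0)); apply: le_trans main.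
rewrite mulr_suml le_eqVlt; apply/orP; left; apply/eqP.
apply: eq_big_seq => p; rewrite mem_perms_of // => /is_perm_size pp.
rewrite tpatE pp -/k -mulrA -exprMn divfK // gt_eqF //.
Qed.

Lemma variance_tpat n x : in_S x -> (size x <= n)%N ->
  \sum_(p <- perms_of n) tcop C p * (tpat R x p - tcop C x) ^+ 2 <= (size x ^ 2)%:R / n%:R.
Proof.
move=> px xn; have n0 : (0 < n)%N by apply: leq_trans xn; case/andP: px.
have h2 := sum_tcop_tpat2 px xn.
have -> : \sum_(p <- perms_of n) tcop C p * (tpat R x p - tcop C x) ^+ 2 =
   \sum_(p <- perms_of n) tcop C p * tpat R x p ^+ 2
   - 2 * tcop C x * \sum_(p <- perms_of n) tcop C p * tpat R x p
   + tcop C x ^+ 2 * \sum_(p <- perms_of n) tcop C p.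
  rewrite !mulr_sumr -sumrB -big_split /=; apply: eq_bigr => p _.
  by ring.
by rewrite sum_tcop_tpat // sum_tcop //; lra.
Qed.

(** One permutation must do for all patterns up to length m, so the squared deviations are summed
    over the finite list [L] of these patterns before averaging with the weights [tcop C p]. *)
Lemma exists_perm_close m : exists p, in_S p /\
  forall x, in_S x -> (size x <= m)%N -> `|tpat R x p - tcop C x| <= m.+1%:R^-1.
Proof.
pose L := undup (flatten [seq perms_of k | k <- iota 1 m]).
have memL x : x \in L -> in_S x /\ (size x <= m)%N.
  rewrite mem_undup => /flattenP[_ /mapP[k + ->]]; rewrite mem_iota add1n ltnS => /andP[k0 km].
  by rewrite mem_perms_of // => px; rewrite (is_perm_size px) (is_perm_in_S px).
have inL x : in_S x -> (size x <= m)%N -> x \in L.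
  move=> px xm; have x0 : (0 < size x)%N by case/andP: px.
  rewrite mem_undup; apply/flattenP; exists (perms_of (size x)); last by rewrite mem_perms_of.
  by apply: map_f; rewrite mem_iota add1n ltnS x0.
(* Large enough for the total variance bound [size L * m ^ 2 / n] to fall below [1 / m.+1 ^ 2]; the
   summand m ensures that all patterns in [L] fit into length n. *)
pose n := (size L * m ^ 2 * m.+1 ^ 2 + m).+1.
pose dev p : R := \sum_(x <- L) (tpat R x p - tcop C x) ^+ 2.
have n0 : (0 < n)%N by [].
have avg : \sum_(p <- perms_of n) tcop C p * dev p < m.+1%:R^-1 ^+ 2.
  apply: (@le_lt_trans _ _ ((size L * m ^ 2)%:R / n%:R)).
    under eq_bigr => p _ do rewrite mulr_sumr.
    rewrite exchange_big /= natrM -mulrA mulr_natl.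
    have -> (c : R) : c *+ size L = \sum_(x <- L) c.
      by rewrite big_const_seq count_predT iter_addr_0.
    rewrite [leLHS]big_seq [leRHS]big_seq; apply: ler_sum => x /memL[px xm].
    apply: le_trans (variance_tpat px _) _; first exact: leq_trans xm (leqW (leq_addl _ _)).
    by rewrite ler_pM2r ?invr_gt0 ?ltr0n // ler_nat leq_sqr.
  rewrite ltr_pdivrMr ?ltr0n // exprVn mulrC ltr_pdivlMr ?exprn_gt0 ?ltr0n //.
  by rewrite -natrX -natrM ltr_nat ltnS leq_addr.
(* Otherwise all deviations would exceed the bound, and so would their mean, the weights being
   nonnegative with sum 1. *)
have [p pn pdev] : exists2 p, p \in perms_of n & dev p <= m.+1%:R^-1 ^+ 2.
  move: (m.+1%:R^-1 ^+ 2 : R) avg => e2 avg.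
  apply: contrapT => /forall2NP no; move: avg; rewrite ltNge => /negP; apply.
  rewrite -[leLHS]mulr1 -(sum_tcop n0) mulr_sumr [leLHS]big_seq [leRHS]big_seq; apply: ler_sum => p pn.
  rewrite mulrC ler_wpM2l ?(tcop_ge0 iid) // ltW // ltNge; apply/negP => h.
  by case: (no p) => [/(_ pn)|/(_ h)].
exists p; split; first by apply: (@is_perm_in_S n); rewrite -mem_perms_of.
move=> x px xm.
have sq : (tpat R x p - tcop C x) ^+ 2 <= m.+1%:R^-1 ^+ 2.
  apply: le_trans pdev; rewrite /dev (bigD1_seq x) ?inL ?undup_uniq //=.
  by rewrite lerDl; apply: sumr_ge0 => z _; exact: sqr_ge0.
by rewrite -ler_sqr ?nnegrE ?invr_ge0 // real_normK // num_real.
Qed.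

End Moments.

Theorem theorem4 (R : realType) (d : measure_display) (Omega : measurableType d)
  (P : probability Omega R) (X Y : nat -> Omega -> R)
  (C : probability (R * R)%type R) :
  is_copula C -> iid_law P X Y C ->
  (* (i) Pi is a Markov chain with the given transition probabilities *)
  (forall (n : nat) (h : nat -> seq nat) (tau : seq nat),
     is_perm n (h n) -> in_SC C (h n) -> is_perm n.+1 tau ->
     0 < Pr P [set w | forall k, (0 < k <= n)%N -> Pi X Y k w = h k] ->
     Pr P [set w | (forall k, (0 < k <= n)%N -> Pi X Y k w = h k)
                   /\ Pi X Y n.+1 w = tau]
     / Pr P [set w | forall k, (0 < k <= n)%N -> Pi X Y k w = h k]
     = n.+1%:R * tcop C tau / tcop C (h n) * pH R (h n) tau) /\
  (* (ii) Doob-Martin topology of Pi = pattern frequency topology on S_C *)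
  (forall y : nat -> seq nat, (forall m, in_SC C (y m)) ->
     ((forall sigma, in_S sigma -> cvgn (fun m => tpat R sigma (y m))) <->
      (forall x, in_SC C x -> cvgn (fun m => DM_fun P X Y x (y m))))) /\
  (* (iii) Pi is the Doob h-transform of Pi^H with h = K(., C) *)
  (exists KC : seq nat -> R,
     (exists y : nat -> seq nat, (forall m, in_S (y m)) /\
        forall rho, in_S rho -> (fun m => tpat R rho (y m)) @ \oo --> tcop C rho) /\
     (forall y : nat -> seq nat, (forall m, in_S (y m)) ->
        (forall rho, in_S rho -> (fun m => tpat R rho (y m)) @ \oo --> tcop C rho) ->
        forall x, in_S x -> (fun m => KH R x (y m)) @ \oo --> KC x) /\
     (forall (n : nat) (sigma tau : seq nat),
        is_perm n sigma -> in_SC C sigma -> is_perm n.+1 tau ->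
        Pr P [set w | Pi X Y n w = sigma /\ Pi X Y n.+1 w = tau]
        / Pr P [set w | Pi X Y n w = sigma]
        = KC tau / KC sigma * pH R sigma tau)).
Proof.
move=> cop iid; split; [|split].
- move=> n h tau pn _ pt pos; exact: (Pi_path_transition cop iid pn pt pos).
- move=> y ySC; split=> cv s ps.
    have -> : (fun m => DM_fun P X Y s (y m)) = (fun m => tpat R s (y m)).
      by apply/funext => m; rewrite (DM_funE cop iid) //; case/andP: ps.
    by apply: cv; case/andP: ps.
  have [sSC|sSC] := boolP (in_SC C s).
    have -> : (fun m => tpat R s (y m)) = (fun m => DM_fun P X Y s (y m)).
      by apply/funext => m; rewrite (DM_funE cop iid).
    exact: cv.
  rewrite (_ : (fun m => _) = fun=> 0 : R); first exact: is_cvg_cst.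
  by apply/funext => m; rewrite (tpat_notin_SC cop iid).
- exists (fun x => (size x)`!%:R * tcop C x); split; [|split].
  (* A fixed [rho] is covered by the m-th approximation as soon as m reaches its length, with error
     at most [1 / m.+1]. *)
  + have [y Hy] := choice (exists_perm_close cop iid).
    exists y; split=> [m|rho prho]; first by case: (Hy m).
    apply/cvgrPdist_le => e e0; near=> m.
    rewrite distrC (le_trans ((Hy m).2 rho prho _)) //.
      by near: m; exact: nbhs_infty_ge.
    by apply: ltW; near: m; exact: (near_infty_natSinv_lt (PosNum e0)).
  + move=> y yS ycvg x px.
    have -> : (fun m => KH R x (y m)) = (fun m => (size x)`!%:R * tpat R x (y m)).
      by apply/funext => m; rewrite KHE.
    by apply: cvgMl_tmp; exact: ycvg.
  + move=> n sigma tau ps /andP[_ s0] pt.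
    (* The quotient of the factorials in [KC tau / KC sigma] is the factor [n.+1] of the transition
       formula. *)
    rewrite (Pi_transition cop iid ps s0 pt) (is_perm_size ps) (is_perm_size pt).
    rewrite factS natrM; field.
    by rewrite gt_eqF //= pnatr_eq0 -lt0n fact_gt0.
Unshelve. all: by end_near.
Qed.
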